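(* Let $k$ be an algebraically closed field of characteristic $0$, $n\ge 2$, $S=k[[X_1,\dots,X_n]]$, and let $R=S/I$ be a one-dimensional (Noetherian complete local) domain with fraction field $K$. Assume $I\subseteq (X_1,\dots,X_n)^{s+1}$ for some $s\ge 1$. Suppose the integral closure of $R$ in $K$ is $\overline{R}=k[[t]]$ with valuation function $v$ (a discrete valuation on $K=k((t))$). Let $x_i(t)$ denote the image of $X_i$ in $\overline{R}$ and set $x_i'(t)=\frac{d}{dt}x_i(t)$. Let $\mathcal{D}=Rx_1'(t)+\dots+Rx_n'(t)\subseteq K$ and $v(\mathcal{D}^{-1})=\min\{v(\alpha)\mid \alpha\in K,\ \alpha\mathcal{D}\subseteq R\}$. If $$v(\mathcal{D}^{-1})<\binom{n+s}{s}\frac{s}{s+1}+\lambda(\overline{R}/R)-\lambda(\overline{R}/\mathcal{D}),$$ then $\Omega_{R/k}$ has torsion, i.e. its torsion submodule is non-zero. (So Berger's Conjecture is true in this case.)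
   Context: $\lambda(\cdot)$ denotes length as an $R$-module. The valuation function $v$ assigns to a non-zero power (Laurent) series in $t$ the least exponent of $t$ occurring in it ($v(0)=\infty$). Universally finite module of differentials: for $R=S/I$ with $S=k[[X_1,\dots,X_n]]$ and $I=(f_1,\dots,f_m)$, $\Omega_{R/k}$ is the finitely generated $R$-module $\left(\bigoplus_{i=1}^n R\,dX_i\right)/U$, where $U$ is the $R$-submodule generated by $df_j=\sum_{i=1}^n \frac{\partial f_j}{\partial X_i}dX_i$, $j=1,\dots,m$. Berger's Conjecture (domain case): for $k$ perfect and $R$ a complete one-dimensional local $k$-algebra which is a domain, $R$ is regular if and only if the torsion submodule of $\Omega_{R/k}$ is zero. *)

(* Defs.v *)
From HB Require Import structures.
From mathcomp Require Import all_boot all_order all_algebra.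
From mathcomp Require Import boolp.
From mathcomp Require Import mpoly.

Set Implicit Arguments.
Unset Strict Implicit.
Unset Printing Implicit Defensive.

Import GRing.Theory.
Local Open Scope ring_scope.
Local Open Scope quotient_scope.

(* k[[t]]: [f i] is the coefficient of t^i in f.  A record rather than a bare
   function type, so that it does not inherit the pointwise product. *)
Record fps (k : Type) := FPS { fps_coef :> nat -> k }.

Section FpsChoice.
Variable k : Type.
HB.instance Definition _ := gen_eqMixin (fps k).
HB.instance Definition _ := gen_choiceMixin (fps k).

Lemma fpsP (f g : fps k) : (forall i, f i = g i) -> f = g.
Proof. by case: f g => f [g] /= /funext ->. Qed.
End FpsChoice.

Section FpsRing.
Variable k : comNzRingType.
Implicit Types f g h : fps k.

Definition fpsC (c : k) : fps k := FPS (fun i => if i == 0%N then c else 0).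
Definition fpsX : fps k := FPS (fun i => (i == 1%N)%:R).
Definition fps_zero : fps k := FPS (fun=> 0).
Definition fps_opp f : fps k := FPS (fun i => - f i).
Definition fps_add f g : fps k := FPS (fun i => f i + g i).
Definition fps_mul f g : fps k :=
  FPS (fun i => \sum_(j < i.+1) f j * g (i - j)%N).
Definition fps_scale (c : k) f : fps k := FPS (fun i => c * f i).

Let addA : associative fps_add.
Proof. by move=> f g h; apply: fpsP => i /=; rewrite addrA. Qed.
Let addC : commutative fps_add.
Proof. by move=> f g; apply: fpsP => i /=; rewrite addrC. Qed.
Let add0 : left_id fps_zero fps_add.
Proof. by move=> f; apply: fpsP => i /=; rewrite add0r. Qed.
Let addN : left_inverse fps_zero fps_opp fps_add.
Proof. by move=> f; apply: fpsP => i /=; rewrite addNr. Qed.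

HB.instance Definition _ := GRing.isZmodule.Build (fps k) addA addC add0 addN.

Definition fps_trunc d f : {poly k} := \poly_(i < d) f i.

Let truncM d f g i : (i < d)%N ->
  fps_mul f g i = (fps_trunc d f * fps_trunc d g)`_i.
Proof.
move=> lid; rewrite coefM /=; apply: eq_bigr => j _.
rewrite !coef_poly (leq_ltn_trans (leq_subr _ _) lid).
by rewrite (leq_ltn_trans _ lid) // -ltnS.
Qed.

Let mulC : commutative fps_mul.
Proof. by move=> f g; apply: fpsP => i; rewrite !(@truncM i.+1) // mulrC. Qed.
Let mulA : associative fps_mul.
Proof.
move=> f g h; apply: fpsP => i; pose T := fps_trunc i.+1.
have -> : fps_mul f (fps_mul g h) i = (T f * (T g * T h))`_i.
  rewrite coefM; apply: eq_bigr => j _.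
  by rewrite (@truncM i.+1) ?ltnS ?leq_subr // coef_poly ltn_ord.
rewrite mulrA [RHS](_ : _ = ((T f * T g) * T h)`_i) //.
rewrite coefM; apply: eq_bigr => j _.
by rewrite (@truncM i.+1) // coef_poly ltnS leq_subr.
Qed.
Let mul1 : left_id (fpsC 1) fps_mul.
Proof.
move=> f; apply: fpsP => i /=; rewrite big_ord_recl /= mul1r subn0 big1 ?addr0 //.
by move=> j _; rewrite mul0r.
Qed.
Let mulDl : left_distributive fps_mul fps_add.
Proof.
move=> f g h; apply: fpsP => i /=; rewrite -big_split /=.
by apply: eq_bigr => j _; rewrite mulrDl.
Qed.
Let nz1 : fpsC 1 != 0.
Proof.
by apply/eqP => /(congr1 (fun f : fps k => f 0%N)) /= /eqP; rewrite oner_eq0.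
Qed.

HB.instance Definition _ :=
  GRing.Zmodule_isComNzRing.Build (fps k) mulA mulC mul1 mulDl nz1.

Let scaleA a b f : fps_scale a (fps_scale b f) = fps_scale (a * b) f.
Proof. by apply: fpsP => i /=; rewrite mulrA. Qed.
Let scale1 : left_id 1 fps_scale.
Proof. by move=> f; apply: fpsP => i /=; rewrite mul1r. Qed.
Let scaleDr : right_distributive fps_scale +%R.
Proof. by move=> a f g; apply: fpsP => i /=; rewrite mulrDr. Qed.
Let scaleDl f : {morph fps_scale^~ f : a b / a + b}.
Proof. by move=> a b; apply: fpsP => i /=; rewrite mulrDl. Qed.

HB.instance Definition _ :=
  GRing.Zmodule_isLmodule.Build k (fps k) scaleA scale1 scaleDr scaleDl.

Let scaleAl (a : k) f g : a *: (f * g) = (a *: f) * g.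
Proof.
apply: fpsP => i /=; rewrite mulr_sumr.
by apply: eq_bigr => j _; rewrite mulrA.
Qed.

HB.instance Definition _ := GRing.Lmodule_isLalgebra.Build k (fps k) scaleAl.
HB.instance Definition _ := GRing.Lalgebra_isComAlgebra.Build k (fps k).

Definition fps_unit : {pred fps k} := [pred f | `[< exists g, g * f = 1 >]].
Definition fps_inv f : fps k :=
  if pselect (exists g, g * f = 1) is left e then projT1 (cid e) else f.

Let mulV : {in fps_unit, left_inverse 1 fps_inv *%R}.
Proof.
move=> f /asboolP uf; rewrite /fps_inv; case: pselect => // e.
by case: (cid e).
Qed.
Let unitP f g : g * f = 1 -> fps_unit f.
Proof. by move=> e; apply/asboolP; exists g. Qed.
Let inv_out : {in [predC fps_unit], fps_inv =1 id}.
Proof.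
move=> f; rewrite !inE /fps_inv; case: pselect => // e /negP[].
by apply/asboolP.
Qed.

HB.instance Definition _ :=
  GRing.ComNzRing_hasMulInverse.Build (fps k) mulV unitP inv_out.

(* d is the least exponent occurring in f, i.e. v(f) = d. *)
Definition fps_ord f (d : nat) : Prop :=
  f d != 0 /\ forall i, (i < d)%N -> f i = 0.

Definition fps_deriv f : fps k := FPS (fun i => f i.+1 *+ i.+1).

End FpsRing.

Lemma fps_ord_ex (k : comNzRingType) (f : fps k) : f != 0 -> exists d, fps_ord f d.
Proof.
move=> nzf; have ex : exists i, f i != 0.
  apply: contrapT => /forallNP H; case/eqP: nzf; apply: fpsP => i.
  by have /negP/negPn/eqP := H i.
case: (ex_minnP ex) => d nzd min; exists d; split=> // i lid.
by apply/eqP/negPn/negP => /min; rewrite leqNgt lid.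
Qed.

Section FpsIdomain.
Variable k : idomainType.

Let integral : GRing.integral_domain_axiom (fps k).
Proof.
move=> f g fg0; apply/orP.
have [_|/fps_ord_ex[a [fa minf]]] := eqVneq f 0; first by left.
have [_|/fps_ord_ex[b [gb ming]]] := eqVneq g 0; first by right.
have := congr1 (fun h : fps k => h (a + b)%N) fg0 => /=.
have lab : (a < (a + b).+1)%N by rewrite ltnS leq_addr.
rewrite (bigD1 (Ordinal lab)) //= addKn big1 ?addr0 => [/eqP|j /eqP nj].
  by rewrite mulf_eq0 (negPf fa) (negPf gb).
have [lj|lj|ej] := ltngtP j a; first by rewrite minf ?mul0r.
  by rewrite ming ?mulr0 // ltn_subLR ?ltn_add2r // -ltnS ltn_ord.
by case: nj; apply: val_inj.
Qed.

HB.instance Definition _ := GRing.ComUnitRing_isIntegral.Build (fps k) integral.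
End FpsIdomain.

(* k((t)) is the fraction field of k[[t]]; z has valuation e when z is the
   Laurent series t^-N f and the least exponent of f is e + N. *)
Notation laurent k := {fraction fps k}.

Definition laurent_val (k : fieldType) (z : laurent k) (e : int) : Prop :=
  exists (N d : nat) (f : fps k),
    [/\ z = tofrac f / tofrac (fpsX k) ^+ N, fps_ord f d & e = d%:Z - N%:Z].

(* k[[X_1..X_n]]: [f m] is the coefficient of the monomial X^m. *)
Record mfps (n : nat) (k : Type) := MFPS { mfps_coef :> 'X_{1..n} -> k }.

Section MfpsChoice.
Variables (n : nat) (k : Type).
HB.instance Definition _ := gen_eqMixin (mfps n k).
HB.instance Definition _ := gen_choiceMixin (mfps n k).

Lemma mfpsP (f g : mfps n k) : (forall m, f m = g m) -> f = g.
Proof. by case: f g => f [g] /= /funext ->. Qed.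
End MfpsChoice.

Section MfpsRing.
Variables (n : nat) (k : comNzRingType).
Implicit Types (f g h : mfps n k) (m : 'X_{1..n}).

Definition mfpsC (c : k) : mfps n k := MFPS (fun m => if m == 0%MM then c else 0).
Definition mfpsX (i : 'I_n) : mfps n k := MFPS (fun m => (m == U_(i)%MM)%:R).
Definition mfps_zero : mfps n k := MFPS (fun=> 0).
Definition mfps_opp f : mfps n k := MFPS (fun m => - f m).
Definition mfps_add f g : mfps n k := MFPS (fun m => f m + g m).
(* The degree bounds only serve to make the index type of the Cauchy product
   finite: they follow from m = h.1 + h.2. *)
Definition mfps_mul f g : mfps n k :=
  MFPS (fun m => \sum_(h : 'X_{1..n < (mdeg m).+1, (mdeg m).+1}
                       | m == (h.1 + h.2)%MM) f h.1 * g h.2).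
Definition mfps_scale (c : k) f : mfps n k := MFPS (fun m => c * f m).

Let addA : associative mfps_add.
Proof. by move=> f g h; apply: mfpsP => i /=; rewrite addrA. Qed.
Let addC : commutative mfps_add.
Proof. by move=> f g; apply: mfpsP => i /=; rewrite addrC. Qed.
Let add0 : left_id mfps_zero mfps_add.
Proof. by move=> f; apply: mfpsP => i /=; rewrite add0r. Qed.
Let addN : left_inverse mfps_zero mfps_opp mfps_add.
Proof. by move=> f; apply: mfpsP => i /=; rewrite addNr. Qed.

HB.instance Definition _ :=
  GRing.isZmodule.Build (mfps n k) addA addC add0 addN.

Definition mfps_trunc d f : {mpoly k[n]} :=
  \sum_(m : 'X_{1..n < d}) f m *: 'X_[m].

Lemma coef_mfps_trunc d f m : (mdeg m < d)%N -> (mfps_trunc d f)@_m = f m.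
Proof.
move=> lmd; rewrite raddf_sum (bigD1 (BMultinom lmd)) //= big1 ?addr0 => [|x nx].
  by rewrite mcoeffZ mcoeffX eqxx mulr1.
rewrite mcoeffZ mcoeffX; case: eqP => [e|]; last by rewrite mulr0.
by case/eqP: nx; apply: val_inj.
Qed.

Let truncM d f g m : (mdeg m < d)%N ->
  mfps_mul f g m = (mfps_trunc d f * mfps_trunc d g)@_m.
Proof.
move=> lmd; rewrite mcoeffM /=; apply: eq_bigr => h _.
by rewrite !coef_mfps_trunc // (leq_trans _ lmd) // bmdeg.
Qed.

Let mulC : commutative mfps_mul.
Proof.
by move=> f g; apply: mfpsP => m; rewrite !(@truncM (mdeg m).+1) // mulrC.
Qed.
Let mulA : associative mfps_mul.
Proof.
move=> f g h; apply: mfpsP => m; pose T := mfps_trunc (mdeg m).+1.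
have -> : mfps_mul f (mfps_mul g h) m = (T f * (T g * T h))@_m.
  rewrite mcoeffM; apply: eq_bigr => x _.
  by rewrite (@truncM (mdeg m).+1) ?coef_mfps_trunc ?bmdeg.
rewrite mulrA [RHS](_ : _ = ((T f * T g) * T h)@_m) //.
rewrite mcoeffM; apply: eq_bigr => x _.
by rewrite (@truncM (mdeg m).+1) ?coef_mfps_trunc ?bmdeg.
Qed.
Let mul1 : left_id (mfpsC 1) mfps_mul.
Proof.
move=> f; apply: mfpsP => m; rewrite (@truncM (mdeg m).+1) //.
rewrite (_ : mfps_trunc _ (mfpsC 1) = 1) ?mul1r ?coef_mfps_trunc //.
rewrite /mfps_trunc (bigD1 (@BMultinom n (mdeg m).+1 0%MM _)) ?mdeg0 //= => H.
rewrite eqxx scale1r mpolyX0 big1 ?addr0 // => x nx.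
case: eqP => [e|]; last by rewrite scale0r.
by case/eqP: nx; apply: val_inj.
Qed.
Let mulDl : left_distributive mfps_mul mfps_add.
Proof.
move=> f g h; apply: mfpsP => i /=; rewrite -big_split /=.
by apply: eq_bigr => j _; rewrite mulrDl.
Qed.
Let nz1 : mfpsC 1 != 0.
Proof.
apply/eqP => /(congr1 (fun f : mfps n k => f 0%MM)) /= /eqP.
by rewrite eqxx oner_eq0.
Qed.

HB.instance Definition _ :=
  GRing.Zmodule_isComNzRing.Build (mfps n k) mulA mulC mul1 mulDl nz1.

Let scaleA a b f : mfps_scale a (mfps_scale b f) = mfps_scale (a * b) f.
Proof. by apply: mfpsP => i /=; rewrite mulrA. Qed.
Let scale1 : left_id 1 mfps_scale.
Proof. by move=> f; apply: mfpsP => i /=; rewrite mul1r. Qed.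
Let scaleDr : right_distributive mfps_scale +%R.
Proof. by move=> a f g; apply: mfpsP => i /=; rewrite mulrDr. Qed.
Let scaleDl f : {morph mfps_scale^~ f : a b / a + b}.
Proof. by move=> a b; apply: mfpsP => i /=; rewrite mulrDl. Qed.

HB.instance Definition _ :=
  GRing.Zmodule_isLmodule.Build k (mfps n k) scaleA scale1 scaleDr scaleDl.

Let scaleAl (a : k) f g : a *: (f * g) = (a *: f) * g.
Proof.
apply: mfpsP => i /=; rewrite mulr_sumr.
by apply: eq_bigr => j _; rewrite mulrA.
Qed.

HB.instance Definition _ := GRing.Lmodule_isLalgebra.Build k (mfps n k) scaleAl.
HB.instance Definition _ := GRing.Lalgebra_isComAlgebra.Build k (mfps n k).

Definition mfps_deriv (i : 'I_n) f : mfps n k :=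
  MFPS (fun m => f (m + U_(i))%MM *+ (m i).+1).

End MfpsRing.

(* S/I is a k-algebra whenever S is. *)
Section QuotientAlgebra.
Variables (k : comNzRingType) (S : comAlgType k) (I : idealr S).
Local Notation Q := {ideal_quot I}.

Definition quot_scale (c : k) (x : Q) : Q := \pi_Q (c *: repr x).

Lemma pi_quot_scale (c : k) (x : S) : quot_scale c (\pi_Q x) = \pi_Q (c *: x).
Proof.
apply/eqP; rewrite -Quotient.idealrBE -scalerBr -mulr_algl idealMr //.
by rewrite Quotient.idealrBE reprK.
Qed.

Let scaleA a b x : quot_scale a (quot_scale b x) = quot_scale (a * b) x.
Proof. by rewrite -[x]reprK !pi_quot_scale scalerA reprK. Qed.
Let scale1 : left_id 1 quot_scale.
Proof. by move=> x; rewrite -[x]reprK pi_quot_scale scale1r. Qed.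
Let scaleDr : right_distributive quot_scale +%R.
Proof.
move=> a x y; rewrite -[x]reprK -[y]reprK -rmorphD !pi_quot_scale.
by rewrite scalerDr rmorphD.
Qed.
Let scaleDl x : {morph quot_scale^~ x : a b / a + b}.
Proof. by move=> a b; rewrite -[x]reprK !pi_quot_scale scalerDl rmorphD. Qed.

HB.instance Definition _ :=
  GRing.Zmodule_isLmodule.Build k Q scaleA scale1 scaleDr scaleDl.

Let scaleAl (a : k) (x y : Q) : a *: (x * y) = (a *: x) * y.
Proof.
rewrite -[x]reprK -[y]reprK -rmorphM.
by rewrite /GRing.scale /= !pi_quot_scale -rmorphM scalerAl.
Qed.

HB.instance Definition _ := GRing.Lmodule_isLalgebra.Build k Q scaleAl.
HB.instance Definition _ := GRing.Lalgebra_isComAlgebra.Build k Q.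

End QuotientAlgebra.

Section Ideals.
Variable R : comNzRingType.

Definition ideal_generated_by m (f : 'I_m -> R) (g : R) : Prop :=
  exists c : 'I_m -> R, g = \sum_j c j * f j.

(* J^e for an ideal J. *)
Definition ideal_pow (J : R -> Prop) (e : nat) (g : R) : Prop :=
  exists (r : nat) (c : 'I_r -> R) (a : 'I_r -> 'I_e -> R),
    (forall i j, J (a i j)) /\ g = \sum_i c i * \prod_j a i j.

Definition prime_ideal (P : {pred R}) : Prop :=
  idealr_closed P /\ prime_idealr_closed P.

Definition prime_chain (d : nat) : Prop :=
  exists P : nat -> {pred R},
    (forall i, (i <= d)%N -> prime_ideal (P i)) /\
    (forall i, (i < d)%N -> {subset P i <= P i.+1} /\ ~ {subset P i.+1 <= P i}).

Definition krull_dim (d : nat) : Prop := prime_chain d /\ ~ prime_chain d.+1.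

End Ideals.

Section Modules.
Variables (R : comNzRingType) (V : lmodType R).

Section Span.
Variables (m : nat) (x : 'I_m -> V).

Definition lspan : {pred V} :=
  [pred v | `[< exists c : 'I_m -> R, v = \sum_j c j *: x j >]].

Lemma lspan_submod_closed : submod_closed lspan.
Proof.
split=> [|a u v].
  by apply/asboolP; exists (fun=> 0); rewrite big1 // => j _; rewrite scale0r.
move=> /asboolP[c ->] /asboolP[c' ->]; apply/asboolP.
exists (fun j => a * c j + c' j); rewrite scaler_sumr -big_split /=.
by apply: eq_bigr => j _; rewrite scalerDl scalerA.
Qed.

HB.instance Definition _ :=
  GRing.isSubmodClosed.Build R V lspan (GRing.submod_closed_semi lspan_submod_closed).
End Span.

Section QuotientModule.
Variable U : submodClosed V.

(* U as an additive subgroup, to which the library's quotient applies. *)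
Definition submod_pred : {pred V} := [pred v | v \in U].

Lemma submod_pred_closed : zmod_closed submod_pred.
Proof. exact: GRing.submod_closedB (GRing.submodClosedP U). Qed.

HB.instance Definition _ :=
  GRing.isZmodClosed.Build V submod_pred submod_pred_closed.

Definition modquot : Type := Quotient.quot submod_pred.
HB.instance Definition _ := GRing.Zmodule.on modquot.
HB.instance Definition _ := Quotient.on modquot.

Definition modquot_scale (r : R) (x : modquot) : modquot :=
  \pi_modquot (r *: repr x).

Lemma modquot_eq (u v : V) : \pi_modquot u = \pi_modquot v <-> u - v \in U.
Proof.
rewrite (_ : (u - v \in U) = (u - v \in submod_pred)) //.
by rewrite Quotient.idealrBE; split=> /eqP.
Qed.

Lemma pi_modquotD (u v : V) :
  \pi_modquot (u + v) = \pi_modquot u + \pi_modquot v.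
Proof. exact: (raddfD (\pi_(Quotient.quot submod_pred))). Qed.

Lemma pi_modquotZ (r : R) (v : V) :
  modquot_scale r (\pi_modquot v) = \pi_modquot (r *: v).
Proof.
by apply/modquot_eq; rewrite -scalerBr rpredZ //; apply/modquot_eq; rewrite reprK.
Qed.

Let scaleA a b x : modquot_scale a (modquot_scale b x) = modquot_scale (a * b) x.
Proof. by rewrite -[x]reprK !pi_modquotZ scalerA reprK. Qed.
Let scale1 : left_id 1 modquot_scale.
Proof. by move=> x; rewrite -[x]reprK pi_modquotZ scale1r. Qed.
Let scaleDr : right_distributive modquot_scale +%R.
Proof.
move=> a x y; rewrite -[x]reprK -[y]reprK -pi_modquotD !pi_modquotZ.
by rewrite scalerDr pi_modquotD.
Qed.
Let scaleDl x : {morph modquot_scale^~ x : a b / a + b}.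
Proof. by move=> a b; rewrite -[x]reprK !pi_modquotZ scalerDl pi_modquotD. Qed.

HB.instance Definition _ :=
  GRing.Zmodule_isLmodule.Build R modquot scaleA scale1 scaleDr scaleDl.
End QuotientModule.

Definition submodule_chain (l : nat) : Prop :=
  exists N : nat -> {pred V},
    (forall i, (i <= l)%N -> submod_closed (N i)) /\
    (forall i, (i < l)%N -> {subset N i <= N i.+1} /\ ~ {subset N i.+1 <= N i}).

(* The length is the supremum of the lengths of chains of submodules; the
   predicate is false for every l when that supremum is infinite. *)
Definition has_length (l : nat) : Prop :=
  submodule_chain l /\ forall l', submodule_chain l' -> (l' <= l)%N.

Definition is_torsion (v : V) : Prop := exists2 r : R, GRing.lreg r & r *: v = 0.

End Modules.

(* B as an A-module through phi. *)
Definition restr (A B : comNzRingType) (phi : {rmorphism A -> B}) : Type := B.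
Arguments restr {A B} phi.

Section Restriction.
Variables (A B : comNzRingType) (phi : {rmorphism A -> B}).
Local Notation restr := (restr phi).

HB.instance Definition _ := GRing.Zmodule.on restr.

Definition restr_scale (a : A) (b : restr) : restr := phi a * (b : B).

Let scaleA a b x : restr_scale a (restr_scale b x) = restr_scale (a * b) x.
Proof. by rewrite /restr_scale mulrA rmorphM. Qed.
Let scale1 : left_id 1 restr_scale.
Proof. by move=> x; rewrite /restr_scale rmorph1 mul1r. Qed.
Let scaleDr : right_distributive restr_scale +%R.
Proof. by move=> a x y; rewrite /restr_scale mulrDr. Qed.
Let scaleDl x : {morph restr_scale^~ x : a b / a + b}.
Proof. by move=> a b; rewrite /restr_scale rmorphD mulrDl. Qed.

HB.instance Definition _ :=
  GRing.Zmodule_isLmodule.Build A restr scaleA scale1 scaleDr scaleDl.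

Definition restr_im : {pred restr} :=
  [pred y : restr | `[< exists a : A, y = phi a >]].

Lemma restr_im_submod_closed : submod_closed restr_im.
Proof.
split=> [|a u v]; first by apply/asboolP; exists 0; rewrite rmorph0.
move=> /asboolP[b ->] /asboolP[c ->]; apply/asboolP.
by exists (a * b + c); rewrite rmorphD rmorphM.
Qed.

HB.instance Definition _ := GRing.isSubmodClosed.Build A restr restr_im
  (GRing.submod_closed_semi restr_im_submod_closed).
End Restriction.

Arguments restr_im {A B} phi.

Section Differentials.
Variables (n : nat) (k : comNzRingType) (I : idealr (mfps n k)).
Local Notation R := {ideal_quot I}.

(* The element df of R dX_1 + ... + R dX_n. *)
Definition differential (f : mfps n k) : 'rV[R]_n :=
  \row_i \pi_R (mfps_deriv i f).

(* Omega_{R/k} for R = k[[X_1..X_n]]/I, presented by generators f of I. *)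
Definition Omega (m : nat) (f : 'I_m -> mfps n k) : lmodType R :=
  modquot (lspan (fun j => differential (f j))).

End Differentials.

Section Parametrization.
Variables (n : nat) (k : fieldType) (I : idealr (mfps n k)).
Local Notation R := {ideal_quot I}.
Variable phi : {rmorphism R -> fps k}.

Definition param_deriv (i : 'I_n) : fps k :=
  fps_deriv (phi (\pi_R (mfpsX k i))).

(* D = R x_1'(t) + ... + R x_n'(t), as an R-submodule of k[[t]]. *)
Definition derivative_module : {pred restr phi} :=
  lspan (param_deriv : 'I_n -> restr phi).
HB.instance Definition _ := GRing.SubmodClosed.on derivative_module.

(* D^-1 = {alpha in K | alpha D is contained in R}. *)
Definition derivative_module_inv (alpha : laurent k) : Prop :=
  forall y : restr phi, y \in derivative_module ->
    exists r : R, alpha * tofrac (y : fps k) = tofrac (phi r).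

End Parametrization.

Arguments derivative_module {n k I} phi.

(* Main.v *)
Require Import Defs.
From HB Require Import structures.
From mathcomp Require Import all_boot all_order all_algebra.
From mathcomp Require Import boolp mpoly zify ring.

Set Implicit Arguments.
Unset Strict Implicit.
Unset Printing Implicit Defensive.

Import Order.TTheory GRing.Theory Num.Theory.
Local Open Scope ring_scope.

(** The length of R / J for an ideal J isomorphic to D is what the hypothesis
    bounds: for alpha in D^-1 of valuation e and J = alpha D, comparing the chains
    J, R, k[[t]] and J, alpha k[[t]], k[[t]] shows that the length of R / J is
    e + length (k[[t]] / D) - length (k[[t]] / R). If Omega is torsion-free, this
    length is at least s / (s + 1) times binom (n + s, s), which gives a
    contradiction. Two facts lie behind that bound.

    First, the map from Omega to D that sends dX_i to x_i' is injective up to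
    torsion ([eval_kernel_relations]). The ring k[[t]] is integral over k[[x_0]]
    by Weierstrass division, so in characteristic 0 each x_i has a separable
    equation over k[[x_0]] ([param_relation]), and the differentials of these
    equations show that Omega has rank one. When Omega is torsion-free, every
    relation between the x_i' is therefore a combination of differentials of
    elements of I.

    Second, this applies to the Koszul relations g_j dX_i - g_i dX_j, where g_i is
    a lift of alpha x_i' ([koszul_relation]). As I lies in (X)^(s+1), the
    coefficients g_i have order at least s. Thus J is generated by n elements of
    m^s. Since R and k[[X]] agree up to degree s, and the polynomials of degree at
    most s form a space of dimension binom (n + s, s), the length of R / J is at
    least binom (n + s, s) - n; more precisely n can be replaced by the rank of the
    s-jets of the g_i ([colength_bound]). For s at least 2 this is enough
    ([leq_mul_binomial]).

    For s = 1 one compares linear terms: the Koszul relations are then, to first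
    order, gradients of quadratic forms. The symmetry of Hessians forces the linear
    parts of the g_i to vanish if n is at least 3, and to form a matrix A of trace
    zero if n = 2. In the latter case A describes the action on m / m^2 of the
    derivation alpha d/dt of R, whose eigenvalues are positive integral multiples
    of one constant, namely the coefficient of t in alpha
    ([eigenvalue_linear_part]). Such numbers have sum zero only if they are zero,
    so A is singular ([rank_jets]).

    Lengths are computed through orders: for an R-submodule L of k[[t]] containing
    some t^N k[[t]], the length of k[[t]] / L is the number of orders that L does
    not attain ([submodule_chain_leq_gaps], [submodule_chain_gaps]). *)

(** * Power series in one variable *)

Definition ord_ge (k : comNzRingType) (d : nat) (f : fps k) : Prop :=
  forall i, (i < d)%N -> f i = 0.

Section FpsOrder.
Variable k : comNzRingType.
Implicit Types f g : fps k.

Lemma fpsD f g i : (f + g) i = f i + g i. Proof. by []. Qed.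
Lemma fpsN f i : (- f) i = - f i. Proof. by []. Qed.
Lemma fpsB f g i : (f - g) i = f i - g i. Proof. by []. Qed.
Lemma fpsZ c f i : (c *: f) i = c * f i. Proof. by []. Qed.
Lemma fps1 i : (1 : fps k) i = (i == 0%N)%:R.
Proof. by rewrite /GRing.one /=; case: eqP. Qed.
Lemma fpsM f g i : (f * g) i = \sum_(j < i.+1) f j * g (i - j)%N.
Proof. by []. Qed.
Lemma fps_sum I (r : seq I) (P : pred I) (F : I -> fps k) i :
  (\sum_(j <- r | P j) F j) i = \sum_(j <- r | P j) F j i.
Proof. by elim/big_rec2: _ => // j x y _ <-. Qed.

Lemma ord_ge0 f : ord_ge 0 f. Proof. by []. Qed.

Lemma ord_geW d e f : (d <= e)%N -> ord_ge e f -> ord_ge d f.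
Proof. by move=> de fe i id; apply: fe; apply: leq_trans de. Qed.

Lemma ord_geD d f g : ord_ge d f -> ord_ge d g -> ord_ge d (f + g).
Proof. by move=> fd gd i id; rewrite fpsD fd // gd // addr0. Qed.

Lemma ord_geN d f : ord_ge d f -> ord_ge d (- f).
Proof. by move=> fd i id; rewrite fpsN fd // oppr0. Qed.

Lemma ord_geB d f g : ord_ge d f -> ord_ge d g -> ord_ge d (f - g).
Proof. by move=> fd gd; apply: ord_geD => //; apply: ord_geN. Qed.

Lemma ord_geZ d c f : ord_ge d f -> ord_ge d (c *: f).
Proof. by move=> fd i id; rewrite fpsZ fd // mulr0. Qed.

Lemma ord_ge_sum d I (r : seq I) (P : pred I) (F : I -> fps k) :
  (forall j, P j -> ord_ge d (F j)) -> ord_ge d (\sum_(j <- r | P j) F j).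
Proof. by move=> Fd i id; rewrite fps_sum big1 // => j Pj; apply: Fd. Qed.

Lemma ord_geM d e f g : ord_ge d f -> ord_ge e g -> ord_ge (d + e) (f * g).
Proof.
move=> fd ge i ide; rewrite fpsM big1 // => j _.
have [/fd->|dj] := ltnP j d; first by rewrite mul0r.
rewrite ge ?mulr0 // ltn_subLR ?(leq_trans ide) ?leq_add2r //.
by rewrite -ltnS ltn_ord.
Qed.

Lemma fpsM_low d e f g : ord_ge d f -> ord_ge e g ->
  (f * g) (d + e)%N = f d * g e.
Proof.
move=> fd ge; have lt : (d < (d + e).+1)%N by rewrite ltnS leq_addr.
rewrite fpsM (bigD1 (Ordinal lt)) //= addKn big1 ?addr0 // => j /eqP nj.
have [lj|lj|ej] := ltngtP j d; first by rewrite fd ?mul0r.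
  by rewrite ge ?mulr0 // ltn_subLR ?ltn_add2r // -ltnS ltn_ord.
by case: nj; apply: val_inj.
Qed.

Lemma fpsM0 f g : (f * g) 0%N = f 0%N * g 0%N.
Proof. exact: (@fpsM_low 0 0). Qed.

Lemma ord_ge_all f : (forall d, ord_ge d f) -> f = 0.
Proof. by move=> fd; apply: fpsP => i; apply: (fd i.+1). Qed.

Lemma fps_ord_ge d f : fps_ord f d -> ord_ge d f. Proof. by case. Qed.

Lemma fps_ord_neq0 d f : fps_ord f d -> f != 0.
Proof. by case=> fd _; apply: contra_neq fd => ->. Qed.

Lemma ord_ge_fps_ord d e f : ord_ge d f -> fps_ord f e -> (d <= e)%N.
Proof.
by move=> fd [fe _]; rewrite leqNgt; apply: contra_neqN fe => /fd.
Qed.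

Lemma fps_ord_uniq d e f : fps_ord f d -> fps_ord f e -> d = e.
Proof.
move=> fd fe; apply/eqP; rewrite eqn_leq.
by rewrite (ord_ge_fps_ord (fps_ord_ge fd)) // (ord_ge_fps_ord (fps_ord_ge fe)).
Qed.

Lemma fpsMX f i : (fpsX k * f) i = if i is i'.+1 then f i' else 0.
Proof.
case: i => [|i]; first by rewrite fpsM big_ord_recl big_ord0 /= mul0r addr0.
rewrite fpsM !big_ord_recl /= mul0r mul1r add0r subSS subn0 big1 ?addr0 // => j _.
by rewrite mul0r.
Qed.

Lemma fpsXnE N i : (fpsX k ^+ N) i = (i == N)%:R.
Proof.
elim: N i => [|N IH] i; first by rewrite expr0 fps1.
by rewrite exprS fpsMX; case: i => // i; rewrite IH eqSS.
Qed.

Lemma fps_ordXn N : fps_ord (fpsX k ^+ N) N.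
Proof.
by split=> [|i iN]; rewrite fpsXnE ?eqxx ?oner_neq0 // ltn_eqF.
Qed.

Lemma fps_trunc_coef d f i : (i < d)%N -> (fps_trunc d f)`_i = f i.
Proof. by move=> id; rewrite coef_poly id. Qed.

Lemma fpsM_trunc d f g i : (i < d)%N ->
  (f * g) i = (fps_trunc d f * fps_trunc d g)`_i.
Proof.
move=> id; rewrite coefM fpsM; apply: eq_bigr => j _.
by rewrite !fps_trunc_coef // ?(leq_ltn_trans (leq_subr _ _) id) // (leq_ltn_trans _ id) // -ltnS.
Qed.

Lemma fps_derivE f i : fps_deriv f i = f i.+1 *+ i.+1. Proof. by []. Qed.

Lemma fps_derivM f g :
  fps_deriv (f * g) = fps_deriv f * g + f * fps_deriv g.
Proof.
apply: fpsP => i; rewrite fps_derivE (@fpsM_trunc i.+2) //.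
rewrite -coef_deriv derivM coefD fpsD !coefM !fpsM; congr (_ + _).
  apply: eq_bigr => j _; rewrite coef_deriv !fps_trunc_coef //.
    by rewrite ltnS (leq_trans (leq_subr _ _)).
  by rewrite !ltnS -ltnS ltn_ord.
apply: eq_bigr => j _; rewrite coef_deriv !fps_trunc_coef //.
  by rewrite !ltnS leq_subr.
by rewrite ltnS ltnW.
Qed.

Lemma fps_derivD f g : fps_deriv (f + g) = fps_deriv f + fps_deriv g.
Proof. by apply: fpsP => i; rewrite /= mulrnDl. Qed.

Lemma fps_derivZ c f : fps_deriv (c *: f) = c *: fps_deriv f.
Proof. by apply: fpsP => i; rewrite /= -mulrnAr. Qed.

Lemma fps_deriv1 : fps_deriv 1 = 0 :> fps k.
Proof. by apply: fpsP => i; rewrite fps_derivE fps1 mul0rn. Qed.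

Lemma ord_ge_deriv d f : ord_ge d.+1 f -> ord_ge d (fps_deriv f).
Proof. by move=> fd i id; rewrite fps_derivE fd // mul0rn. Qed.

End FpsOrder.

Section FpsField.
Variable k : fieldType.
Implicit Types f g z y : fps k.

Lemma fps_ordM d e f g : fps_ord f d -> fps_ord g e -> fps_ord (f * g) (d + e).
Proof.
move=> [fd f0] [ge g0]; split; last exact: ord_geM.
by rewrite fpsM_low // mulf_neq0.
Qed.

Lemma fps_ordX d f j : fps_ord f d -> fps_ord (f ^+ j) (j * d).
Proof.
move=> fd; elim: j => [|j IH]; first by rewrite expr0; apply: (fps_ordXn _ 0).
by rewrite exprS mulSn; apply: fps_ordM.
Qed.

Lemma ord_ge_mull d e f g : fps_ord f d -> ord_ge (d + e) (f * g) -> ord_ge e g.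
Proof.
move=> fd fg; have [->//|/fps_ord_ex[c gc]] := eqVneq g 0.
have := ord_ge_fps_ord fg (fps_ordM fd gc); rewrite leq_add2l => ec.
exact: ord_geW ec (fps_ord_ge gc).
Qed.

(** Series with exactly one member of each order from d on form a topological
    basis of t^d k[[t]]; the coefficients come out by cancelling leading terms
    one at a time. *)
Lemma triangular_expansion d (e : nat -> fps k) z :
    (forall j, fps_ord (e j) (d + j)) -> ord_ge d z ->
  exists c : nat -> k, forall N, ord_ge (d + N) (z - \sum_(j < N) c j *: e j).
Proof.
move=> ed zd.
pose step N (r : fps k) : fps k := r - (r (d + N)%N / e N (d + N)%N) *: e N.
pose rem := fix rem N := if N is N'.+1 then step N' (rem N') else z.
exists (fun N => rem N (d + N)%N / e N (d + N)%N).
have remE N : z - \sum_(j < N) (rem j (d + j)%N / e j (d + j)%N) *: e j = rem N.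
  elim: N => [|N IH]; first by rewrite big_ord0 subr0.
  by rewrite big_ord_recr /= opprD addrA IH.
move=> N; rewrite remE; elim: N => [|N IH]; first by rewrite addn0.
move=> i; rewrite addnS ltnS leq_eqVlt => /orP[/eqP->|iN]; rewrite -[rem N.+1]/(step N (rem N)).
  by rewrite /step fpsB fpsZ divfK ?subrr //; case: (ed N).
by rewrite fpsB fpsZ IH // (proj2 (ed N)) // mulr0 subrr.
Qed.

(** Division in the valuation ring k[[t]], by expanding z along the t^j y. *)
Lemma ord_ge_div d c y z : fps_ord y d -> ord_ge (d + c) z ->
  exists2 w, ord_ge c w & z = w * y.
Proof.
move=> yd zdc.
have [|u uE] := @triangular_expansion d (fun j => fpsX k ^+ j * y) z _
  (ord_geW (leq_addr _ _) zdc).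
  by move=> j; rewrite addnC; apply: fps_ordM => //; apply: fps_ordXn.
suff zE : z = FPS u * y.
  exists (FPS u) => //; apply: (ord_ge_mull yd); by rewrite mulrC -zE.
apply/eqP; rewrite -subr_eq0; apply/eqP/ord_ge_all => N.
rewrite -(subrK (\sum_(j < N) u j *: (fpsX k ^+ j * y)) z) -addrA.
apply: ord_geD; first exact: ord_geW (leq_addl _ _) (uE N).
rewrite (eq_bigr (fun j : 'I_N => (u j *: fpsX k ^+ j) * y)) => [|j _]; last first.
  by rewrite scalerAl.
rewrite -mulr_suml -mulrBl -[X in ord_ge X]addn0; apply: ord_geM => // i iN.
rewrite fpsB fps_sum (bigD1 (Ordinal iN)) //= fpsXnE eqxx mulr1 big1 ?addr0 ?subrr //.
move=> j /eqP nj; rewrite fpsXnE; case: eqP => [ij|]; last by rewrite mulr0.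
by case: nj; apply: val_inj.
Qed.
End FpsField.

(** * Power series in several variables *)

Definition mord_ge (n : nat) (k : comNzRingType) (d : nat) (f : mfps n k) : Prop :=
  forall m, (mdeg m < d)%N -> f m = 0.

Section Mfps.
Variables (n : nat) (k : comNzRingType).
Implicit Types (f g h : mfps n k) (m : 'X_{1..n}) (i j : 'I_n).

Lemma mfpsD f g m : (f + g) m = f m + g m. Proof. by []. Qed.
Lemma mfpsN f m : (- f) m = - f m. Proof. by []. Qed.
Lemma mfpsB f g m : (f - g) m = f m - g m. Proof. by []. Qed.
Lemma mfpsZ c f m : (c *: f) m = c * f m. Proof. by []. Qed.
Lemma mfps1 m : (1 : mfps n k) m = (m == 0%MM)%:R.
Proof. by rewrite /GRing.one /=; case: eqP. Qed.
Lemma mfps_sum I (r : seq I) (P : pred I) (F : I -> mfps n k) m :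
  (\sum_(j <- r | P j) F j) m = \sum_(j <- r | P j) F j m.
Proof. by elim/big_rec2: _ => // j x y _ <-. Qed.
Lemma mfpsM f g m : (f * g) m =
  \sum_(h : 'X_{1..n < (mdeg m).+1, (mdeg m).+1} | m == (h.1 + h.2)%MM)
     f h.1 * g h.2.
Proof. by []. Qed.

Lemma mfpsM_trunc d f g m : (mdeg m < d)%N ->
  (f * g) m = (mfps_trunc d f * mfps_trunc d g)@_m.
Proof.
move=> md; rewrite mcoeffM mfpsM; apply: eq_bigr => h _.
by rewrite !coef_mfps_trunc // (leq_trans _ md) // bmdeg.
Qed.

Lemma mfps_derivE i f m : mfps_deriv i f m = f (m + U_(i))%MM *+ (m i).+1.
Proof. by []. Qed.

Lemma mfps_derivM i f g :
  mfps_deriv i (f * g) = mfps_deriv i f * g + f * mfps_deriv i g.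
Proof.
apply: mfpsP => m; pose d := (mdeg m).+2.
have degU m' : (mdeg m' < (mdeg m).+1)%N -> (mdeg (m' + U_(i)) < d)%N.
  by move=> m'm; rewrite mdegD mdeg1 addn1.
rewrite mfps_derivE (@mfpsM_trunc d) ?degU // -mcoeff_deriv mderivM mcoeffD mfpsD.
rewrite !mcoeffM !mfpsM; congr (_ + _); apply: eq_bigr => h _.
  by rewrite mcoeff_deriv !coef_mfps_trunc ?degU ?bmdeg // ltnW // ltnS bmdeg.
by rewrite mcoeff_deriv !coef_mfps_trunc ?degU ?bmdeg // ltnW // ltnS bmdeg.
Qed.

Lemma mfps_derivD i f g : mfps_deriv i (f + g) = mfps_deriv i f + mfps_deriv i g.
Proof. by apply: mfpsP => m /=; rewrite mulrnDl. Qed.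

Lemma mfps_derivZ i c f : mfps_deriv i (c *: f) = c *: mfps_deriv i f.
Proof. by apply: mfpsP => m; rewrite /= -mulrnAr. Qed.

Lemma mfps_deriv0 i : mfps_deriv i 0 = 0 :> mfps n k.
Proof. by apply: mfpsP => m; rewrite /= mul0rn. Qed.

Lemma mfps_deriv_sum i I (r : seq I) (P : pred I) (F : I -> mfps n k) :
  mfps_deriv i (\sum_(j <- r | P j) F j) = \sum_(j <- r | P j) mfps_deriv i (F j).
Proof.
elim/big_rec2: _ => [|j x y _ <-]; first exact: mfps_deriv0.
exact: mfps_derivD.
Qed.

Lemma mfps_deriv1 i : mfps_deriv i 1 = 0 :> mfps n k.
Proof.
apply: mfpsP => m; rewrite mfps_derivE mfps1.
suff -> : ((m + U_(i))%MM == 0%MM) = false by rewrite mul0rn.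
by apply/negP => /eqP/(congr1 mdeg); rewrite mdegD mdeg1 mdeg0 addn1.
Qed.

Lemma mnm_addU_sub i m : (0 < m i)%N -> exists m', m = (m' + U_(i))%MM.
Proof.
move=> mi; exists (m - U_(i))%MM; rewrite submK //.
by apply/mnm_lepP => j; rewrite mnm1E; case: eqP => // <-.
Qed.

Lemma mfpsMX i f m : (mfpsX k i * f) (m + U_(i))%MM = f m.
Proof.
have degm : (mdeg m < (mdeg (m + U_(i))).+1)%N by rewrite mdegD ltnS leq_addr.
have degU : (mdeg (U_(i))%MM < (mdeg (m + U_(i))).+1)%N.
  by rewrite mdegD ltnS leq_addl.
rewrite mfpsM (bigD1 (BMultinom degU, BMultinom degm)) /=; last by rewrite addmC.
rewrite eqxx mul1r big1 ?addr0 // => -[h1 h2] /= /andP[/eqP mE nh].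
case: eqP => [h1E|]; last by rewrite mul0r.
case/eqP: nh; congr (_, _); apply: val_inj => //=.
apply/eqP; rewrite -(eqm_add2l U_(i)%MM); apply/eqP.
by rewrite -[X in (X + _)%MM = _]h1E -mE addmC.
Qed.

Lemma mfpsMX0 i f m : m i = 0%N -> (mfpsX k i * f) m = 0.
Proof.
move=> mi; rewrite mfpsM big1 // => -[h1 h2] /= /eqP mE.
case: eqP => [h1E|]; last by rewrite mul0r.
have := congr1 (fun m : 'X_{1..n} => m i) mE.
by rewrite mi mnmDE h1E mnm1E eqxx.
Qed.

Lemma mfps_deriv_X i j : mfps_deriv i (mfpsX k j) = (i == j)%:R%:A.
Proof.
apply: mfpsP => m; rewrite mfps_derivE mfpsZ mfps1 /=.
have [->|nij] := eqVneq i j.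
  rewrite mul1r -{2}[U_(j)%MM]add0m eqm_add2r.
  by case: eqP => [->|]; rewrite ?mul0rn // mnm0E.
case: eqP => [/(congr1 (fun m : 'X_{1..n} => m i))|]; last by rewrite mul0r mul0rn.
by rewrite mnmDE !mnm1E eqxx eq_sym (negPf nij) addn1.
Qed.

Lemma mord_geW d e f : (d <= e)%N -> mord_ge e f -> mord_ge d f.
Proof. by move=> de fe i id; apply: fe; apply: leq_trans de. Qed.

Lemma mord_geD d f g : mord_ge d f -> mord_ge d g -> mord_ge d (f + g).
Proof. by move=> fd gd i id; rewrite mfpsD fd // gd // addr0. Qed.

Lemma mord_geN d f : mord_ge d f -> mord_ge d (- f).
Proof. by move=> fd i id; rewrite mfpsN fd // oppr0. Qed.

Lemma mord_geB d f g : mord_ge d f -> mord_ge d g -> mord_ge d (f - g).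
Proof. by move=> fd gd; apply: mord_geD => //; apply: mord_geN. Qed.

Lemma mord_geZ d c f : mord_ge d f -> mord_ge d (c *: f).
Proof. by move=> fd i id; rewrite mfpsZ fd // mulr0. Qed.

Lemma mord_ge_sum d I (r : seq I) (P : pred I) (F : I -> mfps n k) :
  (forall x : I, P x -> mord_ge d (F x)) -> mord_ge d (\sum_(j <- r | P j) F j).
Proof. by move=> Fd i id; rewrite mfps_sum big1 // => j Pj; apply: Fd. Qed.

Lemma mord_geM d e f g : mord_ge d f -> mord_ge e g -> mord_ge (d + e) (f * g).
Proof.
move=> fd ge m md; rewrite mfpsM big1 // => -[h1 h2] /= /eqP mE.
have [/fd->|dh] := ltnP (mdeg h1) d; first by rewrite mul0r.
rewrite ge ?mulr0 // -(ltn_add2l d); apply: leq_ltn_trans md.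
by rewrite [X in (_ <= mdeg X)%N]mE mdegD leq_add2r.
Qed.

Lemma mord_ge_mull d f g : mord_ge d g -> mord_ge d (f * g).
Proof. by move=> gd; apply: (@mord_geM 0). Qed.

Lemma mord_ge_deriv d i f : mord_ge d.+1 f -> mord_ge d (mfps_deriv i f).
Proof.
by move=> fd m md; rewrite mfps_derivE fd ?mul0rn // mdegD mdeg1 addn1.
Qed.

Lemma mfpsM_low d f g m : mord_ge d g -> (mdeg m <= d)%N ->
  (f * g) m = f 0%MM * g m.
Proof.
move=> gd md; have deg0 : (mdeg (0 : 'X_{1..n})%MM < (mdeg m).+1)%N by rewrite mdeg0.
rewrite mfpsM (bigD1 (BMultinom deg0, BMultinom (ltnSn (mdeg m)))) /=; last first.
  by rewrite add0m.
rewrite big1 ?addr0 // => -[h1 h2] /= /andP[/eqP mE nh].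
have [/gd->|dh] := ltnP (mdeg h2) d; first by rewrite mulr0.
case/eqP: nh; have: (mdeg h1 + mdeg h2 <= mdeg h2)%N.
  by rewrite -mdegD -mE (leq_trans md).
rewrite -{2}[mdeg h2]add0n leq_add2r leqn0 mdeg_eq0 => /eqP h1E.
by congr (_, _); apply: val_inj => //=; rewrite -[LHS]add0m -h1E -mE.
Qed.

Lemma mord_ge1 f : mord_ge 1 f <-> f 0%MM = 0.
Proof.
split=> [->//|f0 m]; first by rewrite mdeg0.
by rewrite ltnS leqn0 mdeg_eq0 => /eqP->.
Qed.

(** Each monomial other than 1 is charged to the first variable that occurs in
    it. *)
Definition mfps_div_var (i : 'I_n) f : mfps n k :=
  MFPS (fun m => if [forall j : 'I_n, (j < i)%N ==> (m j == 0%N)]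
                 then f (m + U_(i))%MM else 0).

Lemma mfps_split f : f = (f 0%MM)%:A + \sum_i mfpsX k i * mfps_div_var i f.
Proof.
apply: mfpsP => m; rewrite mfpsD mfpsZ mfps1 mfps_sum.
have [->|m0] := eqVneq m 0%MM.
  by rewrite mulr1 big1 ?addr0 // => i _; rewrite mfpsMX0 // mnm0E.
rewrite mulr0 add0r.
have [i0 mi0] : exists i0, m i0 != 0%N.
  apply/existsP; rewrite -negb_forall; apply: contra m0 => /forallP m0.
  by apply/eqP/mnmP => i; rewrite mnm0E; apply/eqP.
have [i mi imin] := @arg_minnP _ i0 (fun i : 'I_n => m i != 0%N) val mi0.
have [m' mE] := mnm_addU_sub (etrans (lt0n _) mi).
have first_m' : [forall j : 'I_n, (j < i)%N ==> (m' j == 0%N)].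
  apply/forallP => j; apply/implyP => ji; rewrite -leqn0.
  have : m j == 0%N by apply: contraLR ji => /imin; rewrite -leqNgt.
  by move=> /eqP <-; rewrite mE mnmDE leq_addr.
rewrite (bigD1 i) // big1 => [|j ji]; first by rewrite [RHS]addr0 mE mfpsMX /= first_m'.
have [mj0|mj] := posnP (m j); first by rewrite mfpsMX0.
have [m'' mE'] := mnm_addU_sub mj; rewrite mE' mfpsMX /=.
have ij : (i < j)%N.
  by rewrite ltn_neqAle eq_sym [X in X && _]ji imin // -lt0n.
case: ifP => // /forallP/(_ i)/implyP/(_ ij); move: mi.
by rewrite mE' mnmDE mnm1E (negPf ji) addn0 => /negPf->.
Qed.

(** The decomposition [mfps_split] thus generates each power of the ideal (X)
    from the previous one. *)
Lemma mord_ge_div_var d i f : mord_ge d.+1 f -> mord_ge d (mfps_div_var i f).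
Proof.
by move=> fd m md /=; case: ifP => // _; rewrite fd // mdegD mdeg1 addn1.
Qed.

Lemma geometric_inverse i (b : k) :
  exists g : mfps n k, (1 - b *: mfpsX k i) * g = 1.
Proof.
pose g : mfps n k :=
  MFPS (fun m => if m == (U_(i) *+ mdeg m)%MM then b ^+ mdeg m else 0).
exists g; apply: mfpsP => m.
rewrite mulrBl mul1r -scalerAl mfpsB mfpsZ mfps1.
have [m0|mi] := posnP (m i).
  rewrite mfpsMX0 // mulr0 subr0 /=; have [->|nm] := eqVneq m 0%MM.
    by rewrite mdeg0 mulm0n eqxx expr0.
  case: eqP => // mE; move: m0; rewrite mE mulmnE mnm1E eqxx mul1n => /eqP.
  by rewrite mdeg_eq0 (negPf nm).
have [m' mE] := mnm_addU_sub mi; rewrite mE mfpsMX /= mdegD mdeg1 addn1.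
rewrite mulmS addmC eqm_add2l; case: (m' =P _) => [m'E|_].
  rewrite -exprS subrr; case: eqP => // /(congr1 mdeg).
  by rewrite mdegD mdeg1 mdeg0.
rewrite mulr0 subr0; case: eqP => // /(congr1 mdeg).
by rewrite mdegD mdeg1 mdeg0.
Qed.

End Mfps.

(** * Algebra homomorphisms from k[[X]] to k[[t]] *)

Section Parametrized.
Variables (n : nat) (k : fieldType) (psi : {lrmorphism mfps n k -> fps k}).
Implicit Types (f g : mfps n k).
Local Notation x i := (psi (mfpsX k i)).

Lemma paramZ c f : psi (c *: f) = c *: psi f.
Proof. exact: linearZ_LR. Qed.
Lemma paramD f g : psi (f + g) = psi f + psi g. Proof. exact: rmorphD. Qed.
Lemma paramB f g : psi (f - g) = psi f - psi g. Proof. exact: rmorphB. Qed.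
Lemma paramM f g : psi (f * g) = psi f * psi g. Proof. exact: rmorphM. Qed.
Lemma param1 : psi 1 = 1. Proof. exact: rmorph1. Qed.
Lemma param_zero : psi 0 = 0. Proof. exact: rmorph0. Qed.
Lemma paramX f l : psi (f ^+ l) = psi f ^+ l. Proof. exact: rmorphXn. Qed.
Lemma param_sum I (r : seq I) (P : pred I) (F : I -> mfps n k) :
  psi (\sum_(j <- r | P j) F j) = \sum_(j <- r | P j) psi (F j).
Proof. exact: raddf_sum. Qed.

(** Otherwise a scalar multiple of X_i subtracted from 1 would be a unit with
    an image in (t). *)
Lemma param_var0 i : (x i) 0%N = 0.
Proof.
apply/eqP/negPn/negP => x0; have [g gE] := geometric_inverse i ((x i) 0%N)^-1.
have := congr1 (fun h : fps k => h 0%N) (congr1 psi gE).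
rewrite paramM paramB param1 paramZ fpsM0 fpsB fpsZ fps1 mulVf // subrr mul0r.
by move/eqP; rewrite eq_sym oner_eq0.
Qed.

Lemma ord_ge_param_var i : ord_ge 1 (x i).
Proof. by case=> // _; apply: param_var0. Qed.

Lemma param_split f : mord_ge 1 f ->
  psi f = \sum_i x i * psi (mfps_div_var i f).
Proof.
move=> /mord_ge1 f0; rewrite [in LHS](mfps_split f) f0 scale0r add0r param_sum.
by apply: eq_bigr => i _; rewrite paramM.
Qed.

(** Continuity comes for free: algebra homomorphisms respect products, and
    [mfps_split] writes series of high order as finite sums of products. *)
Lemma ord_ge_param d f : mord_ge d f -> ord_ge d (psi f).
Proof.
elim: d f => // d IH f fd; rewrite param_split; last exact: mord_geW fd.
apply: ord_ge_sum => i _; rewrite -[d.+1]add1n.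
by apply: ord_geM; [apply: ord_ge_param_var | apply/IH/mord_ge_div_var].
Qed.

Lemma ord_ge_param_max p f : (forall i, ord_ge p (x i)) -> mord_ge 1 f ->
  ord_ge p (psi f).
Proof.
move=> xp f1; rewrite param_split //; apply: ord_ge_sum => i _.
by rewrite -[p]addn0; apply: ord_geM.
Qed.

Lemma paramC c : psi c%:A = c%:A.
Proof. by rewrite paramZ param1. Qed.

Lemma param0 f : (psi f) 0%N = f 0%MM.
Proof.
have f0 : mord_ge 1 (f - (f 0%MM)%:A).
  by apply/mord_ge1; rewrite mfpsB mfpsZ mfps1 eqxx mulr1 subrr.
have /eqP := ord_ge_param f0 (ltnSn 0).
by rewrite paramB paramC fpsB fpsZ fps1 mulr1 subr_eq0 => /eqP.
Qed.

(** Both sides are derivations along [psi] that agree on the variables; their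
    difference maps the ideal (X) into (t) times its own image, hence vanishes
    to every order. *)
Lemma param_chain_rule f :
  fps_deriv (psi f) = \sum_i psi (mfps_deriv i f) * fps_deriv (x i).
Proof.
pose D f := fps_deriv (psi f) - \sum_i psi (mfps_deriv i f) * fps_deriv (x i).
suff Dord d : forall f, ord_ge d (D f).
  by apply/eqP; rewrite -subr_eq0; apply/eqP/ord_ge_all => d; apply: Dord.
have DD f1 f2 : D (f1 + f2) = D f1 + D f2.
  rewrite /D paramD fps_derivD addrACA -opprD -big_split /=; congr (_ - _).
  by apply: eq_bigr => i _; rewrite mfps_derivD paramD mulrDl.
have DM f1 f2 : D (f1 * f2) = psi f1 * D f2 + D f1 * psi f2.
  have sumE : \sum_i psi (mfps_deriv i (f1 * f2)) * fps_deriv (x i) =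
      psi f1 * (\sum_i psi (mfps_deriv i f2) * fps_deriv (x i)) +
      (\sum_i psi (mfps_deriv i f1) * fps_deriv (x i)) * psi f2.
    rewrite mulr_sumr mulr_suml -big_split /=; apply: eq_bigr => i _.
    by rewrite mfps_derivM paramD !paramM mulrDl addrC mulrA mulrAC.
  rewrite /D paramM fps_derivM sumE mulrBr mulrBl opprD.
  by rewrite [X in X + _ = _]addrC addrACA.
have DX i : D (mfpsX k i) = 0.
  rewrite /D (bigD1 i) //= big1 => [|j ji].
    by rewrite mfps_deriv_X eqxx scale1r param1 mul1r addr0 subrr.
  by rewrite mfps_deriv_X (negPf ji) scale0r param_zero mul0r.
have DC c : D c%:A = 0.
  rewrite /D paramC fps_derivZ fps_deriv1 scaler0 sub0r big1 ?oppr0 // => i _.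
  by rewrite mfps_derivZ mfps_deriv1 scaler0 param_zero mul0r.
have Dsum (F : 'I_n -> mfps n k) : D (\sum_i F i) = \sum_i D (F i).
  apply: (big_morph D DD); rewrite -(scale0r (1 : mfps n k)); exact: DC.
elim: d => // d IH {}f; rewrite (mfps_split f) DD DC add0r Dsum.
apply: ord_ge_sum => i _; rewrite DM DX mul0r addr0 -[d.+1]add1n.
exact: ord_geM (ord_ge_param_var i) (IH _).
Qed.

End Parametrized.

(** * Algebraicity of k[[t]] over k[[x_i]] *)

(** In characteristic 0 these are the series in X_i alone. Vanishing of the other
    derivatives is the form in which this enters the computation of the
    differential of a polynomial relation between x_i and another series, and it
    makes the subring properties immediate. *)
Definition only_var (n : nat) (k : comNzRingType) (i : 'I_n) : {pred mfps n k} :=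
  [pred f | `[< forall j, j != i -> mfps_deriv j f = 0 >]].

Arguments only_var {n} k i.

Section OnlyVar.
Variables (n : nat) (k : comNzRingType) (i : 'I_n).

Lemma only_var_subring_closed : subring_closed (only_var k i).
Proof.
split=> [|f g /asboolP fi /asboolP gi|f g /asboolP fi /asboolP gi]; apply/asboolP => j ji.
- exact: mfps_deriv1.
- by rewrite mfps_derivD fi // -scaleN1r mfps_derivZ gi // scaler0 addr0.
- by rewrite mfps_derivM fi // gi // mul0r mulr0 addr0.
Qed.
HB.instance Definition _ := GRing.isSubringClosed.Build (mfps n k) (only_var k i)
  only_var_subring_closed.

Lemma mfps_derivX j (f : mfps n k) l :
  mfps_deriv j (f ^+ l) = (f ^+ l.-1 * mfps_deriv j f) *+ l.
Proof.
elim: l => [|l IH]; first by rewrite expr0 mfps_deriv1.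
rewrite exprS mfps_derivM IH [mfps_deriv j f * _]mulrC /= mulrS; congr (_ + _).
rewrite -mulrnAr mulrA; case: l {IH} => [|l]; first by rewrite !mulr0n !mulr0.
by rewrite -exprS mulrnAr.
Qed.

Lemma only_var_deriv_horner (P : {poly mfps n k}) j f :
  P \is a polyOver (only_var k i) -> (j != i) ->
  mfps_deriv j P.[f] = P^`().[f] * mfps_deriv j f.
Proof.
move=> /polyOverP PA ji; rewrite -[P]coefK poly_def raddf_sum !horner_sum.
rewrite mfps_deriv_sum mulr_suml; apply: eq_bigr => l _.
rewrite /= derivZ derivXn !hornerZ hornerMn !hornerXn mfps_derivM.
have /asboolP -> // := PA l.
by rewrite mul0r add0r mfps_derivX -mulrnAl mulrA.
Qed.

Definition univariate (u : nat -> k) : mfps n k :=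
  MFPS (fun m => if m == (U_(i) *+ mdeg m)%MM then u (mdeg m) else 0).

Lemma univariate_only_var u : univariate u \in only_var k i.
Proof.
apply/asboolP => j ji; apply: mfpsP => m; rewrite mfps_derivE /=.
case: eqP => [/(congr1 (fun m : 'X_{1..n} => m j))|]; last by rewrite mul0rn.
by rewrite mnmDE mulmnE !mnm1E eqxx eq_sym (negPf ji) mul0n addn1.
Qed.

Lemma mfpsXnE l m : (mfpsX k i ^+ l) m = (m == (U_(i) *+ l)%MM)%:R.
Proof.
elim: l m => [|l IH] m; first by rewrite expr0 mfps1 mulm0n.
rewrite exprS; have [m0|/mnm_addU_sub[m' ->]] := posnP (m i).
  rewrite mfpsMX0 //; case: eqP => // mE.
  by move: m0; rewrite mE mulmnE mnm1E eqxx mul1n.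
by rewrite mfpsMX IH mulmS addmC eqm_add2l.
Qed.

Lemma univariate_trunc u N :
  mord_ge N (univariate u - \sum_(l < N) u l *: mfpsX k i ^+ l).
Proof.
move=> m mN; rewrite mfpsB mfps_sum.
rewrite (eq_bigr (fun l : 'I_N => u l * (m == (U_(i) *+ l)%MM)%:R)) => [|l _].
  rewrite (bigD1 (Ordinal mN)) //= big1 => [|l /eqP nl].
    by case: eqP; rewrite ?mulr1 ?mulr0 addr0 subrr.
  case: eqP => [mE|]; last by rewrite mulr0.
  by case: nl; apply: val_inj; rewrite /= mE mdegMn mdeg1 mul1n.
by rewrite mfpsZ mfpsXnE.
Qed.
End OnlyVar.

Section Separable.
Variables (n : nat) (k : fieldType) (psi : {lrmorphism mfps n k -> fps k}).
Hypothesis char0 : [pchar k] =i pred0.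
Variables (i : 'I_n) (p : nat).
Local Notation x := (psi (mfpsX k i)).
Local Notation A := (only_var k i).
Hypothesis x_ord : fps_ord x p.

Lemma param_univariate_trunc u N :
  ord_ge N (psi (univariate i u) - \sum_(l < N) u l *: x ^+ l).
Proof.
suff -> : psi (univariate i u) - \sum_(l < N) u l *: x ^+ l =
    psi (univariate i u - \sum_(l < N) u l *: mfpsX k i ^+ l).
  exact/ord_ge_param/univariate_trunc.
rewrite paramB param_sum; congr (_ - _).
by apply: eq_bigr => l _; rewrite paramZ paramX.
Qed.

Let p_gt0 : (0 < p)%N.
Proof. exact: ord_ge_fps_ord (ord_ge_param_var _ _) x_ord. Qed.

(** The series x ^+ (m %/ p) * t ^+ (m %% p) have order exactly m, so that every
    series expands along them; collecting the terms with the same m %% p shows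
    that k[[t]] is generated by 1, t, .., t ^+ p.-1 over k[[x]]. *)
Lemma weierstrass_division (g : fps k) : exists a : 'I_p -> mfps n k,
  (forall j, a j \in A) /\ g = \sum_j psi (a j) * fpsX k ^+ j.
Proof.
have eord m : fps_ord (x ^+ (m %/ p) * fpsX k ^+ (m %% p)) (0 + m).
  rewrite add0n [X in fps_ord _ X](divn_eq m p).
  exact: fps_ordM (fps_ordX _ x_ord) (fps_ordXn _ _).
have [c cE] := triangular_expansion eord (ord_ge0 g).
exists (fun j => univariate i (fun l => c (l * p + j)%N)).
split=> [j|]; first exact: univariate_only_var.
apply/eqP; rewrite -subr_eq0; apply/eqP/ord_ge_all => N.
have sumE : \sum_(m < N * p) c m *: (x ^+ (m %/ p) * fpsX k ^+ (m %% p)) =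
    \sum_(j < p) (\sum_(l < N) c (l * p + j)%N *: x ^+ l) * fpsX k ^+ j.
  elim: {cE} N => [|N IH].
    rewrite mul0n big_ord0 big1 // => j _.
    by rewrite big_ord0 mul0r.
  rewrite mulSn addnC big_split_ord /= IH -big_split /=.
  apply: eq_bigr => j _; rewrite big_ord_recr /= mulrDl -scalerAl.
  by rewrite divnMDl // modnMDl divn_small // modn_small // addn0.
rewrite -(subrK (\sum_(m < N * p) c m *: (x ^+ (m %/ p) * fpsX k ^+ (m %% p))) g).
rewrite -addrA; apply: ord_geD; first exact: ord_geW (leq_pmulr _ p_gt0) (cE _).
rewrite sumE -sumrB; apply: ord_ge_sum => j _; rewrite -mulrBl -[N in ord_ge N]addn0.
apply: ord_geM => //; rewrite -opprB; apply: ord_geN.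
exact: param_univariate_trunc.
Qed.

(** Cayley-Hamilton for multiplication by g on the module generated by the powers
    of t. The coefficients are kept in k[[X]], where they can be
    differentiated. *)
Lemma param_integral (g : fps k) : exists P : {poly mfps n k},
  [/\ P \is a polyOver A, map_poly psi P \is monic & root (map_poly psi P) g].
Proof.
have /choice[a aE] := fun j : 'I_p => weierstrass_division (g * fpsX k ^+ j).
pose M := \matrix_(j, l) a j l; exists (char_poly M).
rewrite map_char_poly char_poly_monic; split=> //.
  apply: rpred_sum => s _; apply: rpredM; first exact: rpred_sign.
  apply: rpred_prod => j _; rewrite !mxE; apply: rpredB.
    by apply: rpredMn; apply: polyOverX.
  by rewrite polyOverC; case: (aE j) => aA _; apply: aA.
pose B := map_mx psi M; pose v := \col_(j < p) (fpsX k ^+ j : fps k).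
have Bv : (g%:M - B) *m v = 0.
  rewrite mulmxBl mul_scalar_mx; apply/eqP; rewrite subr_eq0; apply/eqP/colP => j.
  rewrite !mxE; case: (aE j) => _ ->.
  by apply: eq_bigr => l _; rewrite !mxE.
have /rowP detv : \det (g%:M - B) *: v^T = 0.
  by rewrite -trmx0 -linearZ -mul_scalar_mx -mul_adj_mx -mulmxA Bv mulmx0.
have := detv (Ordinal p_gt0); rewrite !mxE expr0 mulr1 => det0.
rewrite /root -det0 -[_.[_]]/(horner_eval g _) -det_map_mx; apply/eqP.
congr (\det _); apply/matrixP => j l; rewrite !mxE /= /horner_eval hornerD hornerN hornerC.
by rewrite hornerMn hornerX.
Qed.

Lemma pchar_fps0 : [pchar fps k] =i pred0.
Proof.
move=> q; apply/negP => /andP[q_pr /eqP q0].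
suff : q \in [pchar k] by rewrite char0.
apply/andP; split => //; have : (q%:R : fps k) 0%N = 0 by rewrite q0.
by rewrite -scaler_nat fpsZ fps1 mulr1 => ->.
Qed.

(** A polynomial of least degree among those with coefficients in k[[x]] that
    vanish at g is separable at g in characteristic 0. *)
Lemma param_separable (g : fps k) : exists P : {poly mfps n k},
  [/\ P \is a polyOver A, (map_poly psi P).[g] = 0
    & (map_poly psi P^`()).[g] != 0].
Proof.
pose Q P := [/\ P \is a polyOver A, map_poly psi P != 0 & root (map_poly psi P) g].
have ex_d : exists d, `[< exists2 P, Q P & size P = d >].
  have [P [PA Pm Pg]] := param_integral g; exists (size P); apply/asboolP.
  by exists P => //; split=> //; apply: monic_neq0.
case: (ex_minnP ex_d) => _ /asboolP[P [PA P0 Pg] <-] minP; exists P; split=> //.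
  exact/eqP.
apply/negP => P'g; suff [PC|dP0] : size P == 0%N \/ map_poly psi P^`() = 0.
- by move: P0; rewrite size_poly_eq0 in PC; rewrite (eqP PC) rmorph0 eqxx.
- have sz1 : (size (map_poly psi P) <= 1)%N.
    rewrite leqNgt; apply/negP => sz; 
    have : (map_poly psi P)^`()`_(size (map_poly psi P)).-2 = 0.
      by rewrite deriv_map dP0 coef0.
    rewrite coef_deriv prednK; last by rewrite -ltnS (ltn_predK sz).
    move/eqP; rewrite -mulr_natr mulf_eq0 ((pcharf0P _).1 pchar_fps0).
    have -> /= : ((size (map_poly psi P)).-1 == 0)%N = false.
      by apply/negbTE; rewrite -lt0n -ltnS (ltn_predK sz).
    by rewrite -lead_coefE lead_coef_eq0 (negPf P0).
  have PC := size1_polyC sz1; move: Pg; rewrite PC /root hornerC => /eqP c0.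
  by move: P0; rewrite PC c0 eqxx.
- have [|nP] := boolP (size P == 0%N); first by left.
  right; apply/eqP/negPn/negP => dP0.
  have : (size P <= size P^`())%N.
    apply: minP; apply/asboolP; exists P^`() => //; split=> //.
    by apply: polyOver_deriv.
  by rewrite leqNgt lt_size_deriv // -size_poly_eq0.
Qed.

(** The separable equation of x_j over k[[x_i]], read as a series F in X_i and
    X_j: its differential involves dX_i and dX_j only, the latter with a nonzero
    coefficient. *)
Lemma param_relation j : j != i -> exists F : mfps n k,
  [/\ psi F = 0, psi (mfps_deriv j F) != 0
    & forall l, l != i -> l != j -> mfps_deriv l F = 0].
Proof.
move=> ji; have [P [PA Pg Pg']] := param_separable (psi (mfpsX k j)).
exists P.[mfpsX k j]; split; first by rewrite -horner_map.
  rewrite (only_var_deriv_horner _ PA) // mfps_deriv_X eqxx scale1r mulr1.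
  by rewrite -horner_map.
move=> l li lj; rewrite (only_var_deriv_horner _ PA) // mfps_deriv_X (negPf lj).
by rewrite scale0r mulr0.
Qed.
End Separable.

(** * Orders attained by a subspace of k[[t]] *)

Section Values.
Variable k : fieldType.
Implicit Types (L : fps k -> Prop) (z : fps k).

Definition attains L (i : nat) : Prop := exists2 z, L z & fps_ord z i.

Definition gap L (i : nat) : bool := ~~ `[< attains L i >].

(** For an R-submodule L of k[[t]] that contains t^N k[[t]] this is the length of
    k[[t]] / L; counting orders turns additivity of lengths into additivity of
    finite cardinals. *)
Definition gaps (N : nat) L : nat := \sum_(i < N) gap L i.

Definition lin_closed L : Prop := forall c z w, L z -> L w -> L (c *: z + w).

Lemma gap_sub L L' i : (forall z, L z -> L' z) -> gap L' i -> gap L i.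
Proof.
move=> sub; apply: contra => /asboolP[z Lz zi]; apply/asboolP.
by exists z => //; apply: sub.
Qed.

Lemma leq_gaps N L L' : (forall z, L z -> L' z) -> (gaps N L' <= gaps N L)%N.
Proof.
move=> sub; apply: leq_sum => i _; have := @gap_sub L L' i sub.
by case: (gap L' i) => // ->.
Qed.

(** An element of L' is brought into L by cancelling its leading terms with
    elements of L until its order reaches N. *)
Lemma eq_values_sub N L L' : lin_closed L -> lin_closed L' ->
    (forall z, ord_ge N z -> L z) -> (forall z, L z -> L' z) ->
    (forall i, (i < N)%N -> gap L i -> gap L' i) ->
  forall z, L' z -> L z.
Proof.
move=> Ls L's tail sub gapLL'.
suff step d : (d <= N)%N -> forall z, ord_ge (N - d) z -> L' z -> L z.
  by move=> z; apply: (step N) => //; rewrite subnn.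
elim: d => [_ z|d IH dN z zd L'z]; first by rewrite subn0 => /tail.
have {}IH := IH (ltnW dN); have Nd : (N - d = (N - d.+1).+1)%N by rewrite subnSK.
set i := (N - d.+1)%N in zd Nd.
have up w : ord_ge i w -> w i = 0 -> ord_ge (N - d) w.
  by move=> wi w0 j; rewrite Nd ltnS leq_eqVlt => /orP[/eqP->//|/wi].
have [z0|z0] := eqVneq (z i) 0; first by apply: IH => //; apply: up.
have iN : (i < N)%N by rewrite ltn_subrL (leq_ltn_trans _ dN).
have [y Ly [y0 yi]] : attains L i.
  apply: contrapT => noL; have gapL : gap L i by apply/asboolPn.
  have /negP := gapLL' i iN gapL; apply; by apply/asboolP; exists z.
rewrite -[z](subrKC ((z i / y i) *: y)).
apply: Ls => //; apply: IH.
  apply: up; first by apply: ord_geB => //; apply: ord_geZ.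
  by rewrite fpsB fpsZ divfK // subrr.
by rewrite addrC -scaleNr; apply: L's => //; apply: sub.
Qed.

Lemma ltn_gaps N L L' : lin_closed L -> lin_closed L' ->
    (forall z, ord_ge N z -> L z) -> (forall z, L z -> L' z) ->
    ~ (forall z, L' z -> L z) ->
  (gaps N L' < gaps N L)%N.
Proof.
move=> Ls L's tail sub nsub; rewrite ltnNge; apply/negP => le_gaps; apply: nsub.
apply: (eq_values_sub Ls L's tail sub) => i iN gapi.
have [//|ngap] := boolP (gap L' i); move: le_gaps; rewrite leqNgt => /negP[].
rewrite /gaps.
rewrite (bigD1 (Ordinal iN)) // [X in (_ < X)%N](bigD1 (Ordinal iN)) //=.
rewrite gapi (negbTE ngap) add0n add1n ltnS; apply: leq_sum => j _.
by have := @gap_sub L L' j sub; case: (gap L' j) => // ->.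
Qed.

Lemma gaps_flag N (L : nat -> fps k -> Prop) l :
    (forall i, (i <= l)%N -> lin_closed (L i)) ->
    (forall z, ord_ge N z -> L 0%N z) ->
    (forall i, (i < l)%N ->
       (forall z, L i z -> L i.+1 z) /\ ~ (forall z, L i.+1 z -> L i z)) ->
  (gaps N (L l) + l <= gaps N (L 0%N))%N.
Proof.
move=> st tail; elim: l st => [|l IH] st step; first by rewrite addn0.
have tails i : (i <= l.+1)%N -> forall z, ord_ge N z -> L i z.
  elim: i => [|i IHi] il z zN; first exact: tail.
  by apply: (proj1 (step i il)); apply: IHi => //; apply: ltnW.
have lt := @ltn_gaps N (L l) (L l.+1) (st _ (leqnSn l)) (st _ (leqnn _))
  (tails l (leqnSn l)) (proj1 (step l (ltnSn l))) (proj2 (step l (ltnSn l))).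
rewrite addnS -addSn (leq_trans _ (IH _ _)) ?leq_add2r //.
  by move=> i il; apply: st; apply: leqW.
by move=> i il; apply: step; apply: ltnW.
Qed.

Lemma gaps_shift N L L' (a : fps k) e : fps_ord a e ->
    (forall z, L z -> L' (a * z)) ->
  (gaps (e + N) L' <= e + gaps N L)%N.
Proof.
move=> ae sub; rewrite /gaps big_split_ord /=; apply: leq_add.
  rewrite -[X in (_ <= X)%N]card_ord -sum1_card; apply: leq_sum => i _.
  by case: (gap _ _).
apply: leq_sum => i _; suff: gap L' (e + i) -> gap L i by case: (gap L' _) => // ->.
apply: contra => /asboolP[z Lz zi]; apply/asboolP; exists (a * z); first exact: sub.
exact: fps_ordM.
Qed.
End Values.

(** * Lengths of quotients of k[[t]] *)

Lemma pi_modquot0 (R : comNzRingType) (V : lmodType R) (U : submodClosed V) :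
  \pi_(modquot U)%qT 0 = 0.
Proof.
by apply: (@addrI _ (\pi_(modquot U)%qT 0)); rewrite -pi_modquotD !addr0.
Qed.

Section Lengths.
Local Open Scope quotient_scope.
Variables (k : fieldType) (R : comAlgType k) (phi : {lrmorphism R -> fps k}).
Local Notation V := (restr phi).

Let phiD r r' : phi (r + r') = phi r + phi r'. Proof. exact: rmorphD. Qed.
Let phiM r r' : phi (r * r') = phi r * phi r'. Proof. exact: rmorphM. Qed.

Lemma restr_scaleE (r : R) (z : V) : r *: z = phi r * (z : fps k). Proof. by []. Qed.

Lemma restr_scaleC c (z : V) : (c%:A : R) *: z = (c *: (z : fps k)) :> fps k.
Proof. by rewrite restr_scaleE linearZ_LR rmorph1 -scalerAl mul1r. Qed.

Section Quotient.
Variable U : submodClosed V.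
Local Notation W := (modquot U).
Local Notation pi := (\pi_W).

Lemma submod_closed_preim (N : {pred W}) : submod_closed N ->
  lin_closed (fun z : fps k => pi z \in N).
Proof.
move=> [_ Ncl] c z w Nz Nw; rewrite -restr_scaleC.
have -> : pi ((c%:A : R) *: (z : V) + (w : V)) = (c%:A : R) *: pi z + pi w.
  by rewrite pi_modquotD -pi_modquotZ.
exact: Ncl.
Qed.

(** R-submodules are k-subspaces, and each strict inclusion of subspaces fills
    at least one gap. *)
Lemma submodule_chain_leq_gaps N l : (forall z : fps k, ord_ge N z -> (z : V) \in U) ->
  submodule_chain W l -> (l <= gaps N (fun z : fps k => (z : V) \in U))%N.
Proof.
move=> tail [M [Mcl Mstep]].
have UM z : (z : V) \in U -> pi z \in M 0%N.
  move=> Uz; have -> : pi z = 0; last by case: (Mcl 0%N isT).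
  by rewrite -pi_modquot0; apply/modquot_eq; rewrite subr0.
apply: leq_trans (leq_gaps N UM).
rewrite -[l in (l <= _)%N]add0n.
apply: leq_trans (@gaps_flag _ N (fun i z => pi z \in M i) l _ _ _).
- by rewrite leq_add2r.
- by move=> i il; apply: submod_closed_preim; apply: Mcl.
- by move=> z zN; apply/UM/tail.
- move=> i il; have [sub nsub] := Mstep i il; split=> [z|sub']; first exact: sub.
  by apply: nsub => x; rewrite -[x]reprK; apply: sub'.
Qed.

Let chain_below (A : {pred W}) (l : nat) := exists M : nat -> {pred W},
  [/\ forall i, (i <= l)%N -> submod_closed (M i),
      forall i, (i < l)%N -> {subset M i <= M i.+1} /\ ~ {subset M i.+1 <= M i}
    & {subset M l <= A}].

Let above (m : nat) : {pred W} :=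
  [pred y | `[< exists2 z : V, ord_ge m (z : fps k) & y = pi z >]].

Let aboveP m (z : V) : ord_ge m (z : fps k) -> pi z \in above m.
Proof. by move=> zm; apply/asboolP; exists z. Qed.

Let above_submod m : submod_closed (above m).
Proof.
split=> [|a x y /asboolP[z zm ->] /asboolP[w wm ->]].
  by rewrite -pi_modquot0; apply: aboveP.
have -> : a *: pi z + pi w = pi (a *: z + w).
  by rewrite pi_modquotD -pi_modquotZ.
apply: aboveP; apply: ord_geD => //; rewrite -[m]add0n.
exact: ord_geM.
Qed.

(** The submodules (t^m k[[t]] + U) / U drop at m exactly when U has no element
    of order m. *)
Lemma submodule_chain_gaps N :
  submodule_chain W (gaps N (fun z : fps k => (z : V) \in U)).
Proof.
set L := (fun z : fps k => _).
suff H j m : (m + j = N)%N -> chain_below (above m) (\sum_(m <= i < N) gap L i).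
  have [M [Mcl Mstep _]] := H N 0%N erefl.
  by exists M; rewrite /gaps -(big_mkord xpredT (fun i => nat_of_bool (gap L i))).
elim: j m => [m|j IH m mN].
  rewrite addn0 => ->; rewrite big_geq //; exists (fun=> above N); by split.
have {IH} [|M [Mcl Mstep Msub]] := IH m.+1; first by rewrite addSnnS.
have sub : {subset above m.+1 <= above m}.
  move=> x /asboolP[z zm ->]; apply: aboveP; exact: ord_geW zm.
rewrite big_ltn; last by rewrite -mN -addSnnS leq_addr.
set l := (\sum_(_ <= _ < _) _)%N in Mcl Mstep Msub *.
have [gm|] := boolP (gap L m); last first.
  by move=> _; rewrite add0n; exists M; split=> // x /Msub /sub.
rewrite add1n; exists (fun i => if (i <= l)%N then M i else above m); split.
- by move=> i _; case: ifP => [/Mcl//|_]; apply: above_submod.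
- move=> i; rewrite ltnS leq_eqVlt => /orP[/eqP->|il]; last first.
    by rewrite /= il orbT; apply: Mstep.
  rewrite /= eqxx ltnn; split=> [x /Msub/sub//|sub']; move: gm => /asboolPn; apply.
  have tm : pi (fpsX k ^+ m : V) \in above m.
    by apply: aboveP; apply: fps_ord_ge (fps_ordXn _ _).
  have /asboolP[w wm /modquot_eq Uw] := Msub _ (sub' _ tm).
  exists (fpsX k ^+ m - w) => //.
  have [X1 X0] := fps_ordXn k m; split=> [|i' i'm].
    by rewrite fpsB wm // subr0.
  by rewrite fpsB X0 // wm ?subr0 // ltnW.
- by rewrite /= ltnn.
Qed.

End Quotient.

(** The submodules of those z with b z in R form a directed family that exhausts
    k[[t]]; it has a greatest member because k[[t]] / R has finite length. *)
Lemma conductor l : has_length (modquot (restr_im phi)) l ->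
    (forall z : fps k, exists a b, phi b != 0 /\ phi b * z = phi a) ->
  exists c, forall z, ord_ge c z -> exists a, z = phi a.
Proof.
move=> [_ maxl] frac.
pose den b (z : fps k) := exists a, phi b * z = phi a.
suff [b b0 allb] : exists2 b, phi b != 0 & forall z, den b z.
  have [c bc] := fps_ord_ex b0; exists c => z zc.
  have [|w _ ->] := @ord_ge_div _ c 0 (phi b) z bc; first by rewrite addn0.
  by have [a aE] := allb w; exists a; rewrite mulrC.
apply: contrapT => nob.
have /choice[next nextP] : forall b, exists b', phi b != 0 ->
    phi b' != 0 /\ exists2 z, den (b * b') z & ~ den b z.
  move=> b; have [b0|b0] := eqVneq (phi b) 0; first by exists 1.
  have [z nz] : exists z, ~ den b z.
    by apply: contrapT => all; apply: nob; exists b => // z; apply: contrapT => nz; apply: all; exists z.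
  have [a [b' [b'0 b'z]]] := frac z; exists b' => _; split=> //; exists z => //.
  by exists (b * a); rewrite !phiM -mulrA b'z.
pose b := fix b i := if i is i'.+1 then b i' * next (b i') else 1.
have b0 i : phi (b i) != 0.
  elim: i => [|i IH] /=; first by rewrite rmorph1 oner_neq0.
  by rewrite phiM mulf_neq0 //; case: (nextP _ IH).
pose W := modquot (restr_im phi).
pose M i : {pred W} := [pred x | `[< exists2 z, den (b i) z & x = \pi_W (z : V) >]].
have MP i z : \pi_W (z : V) \in M i <-> den (b i) z.
  split=> [/asboolP[w [a wE] /modquot_eq/asboolP[r rE]]|dz]; last first.
    by apply/asboolP; exists z.
  exists (b i * r + a); rewrite phiD phiM -wE -rE mulrBr.
  by rewrite subrK.
suff /maxl : submodule_chain W l.+1 by rewrite ltnn.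
exists M; split=> [i _|i _]; last first.
  have [_ [z dz ndz]] := nextP _ (b0 i); split=> [x|sub]; last first.
    by apply: ndz; apply/MP/sub/MP.
  rewrite -[x]reprK => /MP[a aE]; apply/MP; exists (next (b i) * a).
  by rewrite /= !phiM -aE mulrAC mulrC mulrA.
split=> [|r x y]; first by rewrite -pi_modquot0; apply/MP; exists 0; rewrite mulr0 rmorph0.
rewrite -[x]reprK -[y]reprK => /MP[a aE] /MP[a' a'E].
rewrite [r *: _]pi_modquotZ -pi_modquotD; apply/MP; exists (r * a + a').
by rewrite phiD phiM -aE -a'E mulrDr restr_scaleE mulrCA.
Qed.
End Lengths.

(** * A lower bound for the colength of an ideal generated by n series *)

Lemma mx_flag (k : fieldType) (m C : nat) (G : 'M[k]_(m, C)) :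
  exists T : nat -> 'M[k]_C, (T 0%N :=: G)%MS /\
    forall i, (i < C - \rank G)%N -> (T i < T i.+1)%MS.
Proof.
pose step (T : 'M[k]_C) :=
  if [pick j | ~~ (row j 1%:M <= T)%MS] is Some j then (T + row j 1%:M)%MS else T.
have step_sub T : (T <= step T)%MS.
  by rewrite /step; case: pickP => // j _; apply: addsmxSl.
have rank_step T : (\rank (step T) <= (\rank T).+1)%N.
  rewrite /step; case: pickP => // j _; rewrite -[X in (_ <= X)%N]addn1.
  by rewrite (leq_trans (leq_of_leqif (mxrank_adds_leqif _ _))) // leq_add2l rank_leq_row.
have step_lt T : (\rank T < C)%N -> (T < step T)%MS.
  move=> lt; rewrite ltmxE step_sub /step; case: pickP => [j nj|all].
    by apply: contra nj; apply: submx_trans; apply: addsmxSr.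
  move: lt; rewrite ltnNge; case/negP; rewrite col_leq_rank -sub1mx.
  by apply/row_subP => j; have /negbFE := all j.
exists (fun i => iter i step <<G>>%MS); split; first exact: genmxE.
have rankT i : (\rank (iter i step <<G>>%MS) <= \rank G + i)%N.
  elim: i => [|i IH]; first by rewrite addn0 /= genmxE.
  by rewrite (leq_trans (rank_step _)) // addnS ltnS.
move=> i il; apply: step_lt; apply: leq_ltn_trans (rankT i) _.
by rewrite -ltn_subRL.
Qed.

Lemma card_bmultinom n s : #|{: 'X_{1..n < s.+1}}| = 'C(n + s, s).
Proof.
rewrite -[s in 'C(_, s)](addKn n) bin_sub ?leq_addr //.
rewrite -card_partial_ord_partitions.
pose F (m : 'X_{1..n < s.+1}) : n.-tuple 'I_s.+1 := [tuple inord (m i) | i < n].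
have mlt (m : 'X_{1..n < s.+1}) i : (m i < s.+1)%N.
  by apply: leq_ltn_trans (bmdeg m); rewrite mdegE (bigD1 i) //= leq_addr.
have FE m i : (tnth (F m) i : nat) = m i by rewrite tnth_mktuple inordK.
have Finj : injective F.
  move=> m m' eF; apply/val_inj/mnmP => i.
  by rewrite -!FE eF.
rewrite -cardsT -(card_imset _ Finj); apply: eq_card => t; rewrite inE.
have sumE : (\sum_(i <- t) i)%N = mdeg [multinom (tnth t i : nat) | i < n].
  by rewrite mdegE big_tuple; apply: eq_bigr => i _; rewrite mnmE.
apply/imsetP/idP => [[m _ ->]|lt].
  rewrite big_tuple (eq_bigr (fun i => (m : 'X_{1..n}) i)) => [|i _]; last exact: FE.
  by rewrite -mdegE -ltnS bmdeg.
rewrite sumE -ltnS in lt; exists (BMultinom lt) => //.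
by apply: eq_from_tnth => i; apply: val_inj; rewrite /= FE mnmE.
Qed.

(** Equality holds for n = s = 2. The analogue for s = 1 fails, which is why that
    case needs a finer argument. *)
Lemma leq_mul_binomial n s : (2 <= n)%N -> (2 <= s)%N -> (s.+1 * n <= 'C(n + s, s))%N.
Proof.
move=> n2; elim: s => // -[//|[_ _|s IH _]].
  have := mul_bin_diag n.+2 1; rewrite bin1 /= addn2; set b := 'C(_, _) => E.
  by nia.
have {IH} := IH isT; have := mul_bin_diag (n + s.+3) s.+2.
have -> : (n + s.+3).-1 = (n + s.+2)%N by rewrite addnS.
set b := 'C(_, s.+2); set b' := 'C(_, s.+3) => E IH.
suff: (s.+3 * (s.+4 * n) <= s.+3 * b')%N by rewrite leq_pmul2l.
by rewrite -E; nia.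
Qed.

Section Colength.
Variables (n : nat) (k : fieldType) (psi : {lrmorphism mfps n k -> fps k}).
Variables (s : nat).
Hypothesis ker_psi : forall f, psi f = 0 -> mord_ge s.+1 f.

Definition jet (f : mfps n k) : 'rV[k]_#|{: 'X_{1..n < s.+1}}| :=
  \row_(j < #|{: 'X_{1..n < s.+1}}|) f (enum_val j : 'X_{1..n < s.+1}).

Lemma jetD f g : jet (f + g) = jet f + jet g.
Proof. by apply/rowP => j; rewrite !mxE. Qed.
Lemma jetZ c f : jet (c *: f) = c *: jet f.
Proof. by apply/rowP => j; rewrite !mxE. Qed.

Lemma jet0 f : mord_ge s.+1 f -> jet f = 0.
Proof. by move=> f0; apply/rowP => j; rewrite !mxE f0 // bmdeg. Qed.

Lemma jet_surj v : exists f, jet f = v.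
Proof.
exists (MFPS (fun m => if insub m is Some m' then v 0 (enum_rank (m' : 'X_{1..n < s.+1})) else 0)).
apply/rowP => j; rewrite mxE /= insubT ?bmdeg // => lt.
by congr (v _ _); rewrite -[RHS]enum_valK; congr enum_rank; apply: val_inj.
Qed.

Variable g : 'I_n -> mfps n k.
Hypothesis g_ord : forall i, mord_ge s (g i).

Definition jets : 'M[k]_(n, _) := \matrix_i jet (g i).

Lemma jet_comb (c : 'I_n -> mfps n k) : (jet (\sum_i c i * g i)%R <= jets)%MS.
Proof.
have -> : jet (\sum_i c i * g i) = \sum_i c i 0%MM *: row i jets.
  apply/rowP => j; rewrite mxE mfps_sum summxE; apply: eq_bigr => i _.
  by rewrite !mxE (mfpsM_low _ (g_ord i)) // -ltnS bmdeg.
by apply: summx_sub => i _; apply: scalemx_sub; apply: row_sub.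
Qed.

(** Forgetting the terms of degree above s maps R onto the polynomials of degree
    at most s, and the ideal generated by the g i, which have order at least s,
    into the span of n vectors. *)
Lemma colength_bound N (J : fps k -> Prop) :
    (forall z, J z -> exists c : 'I_n -> mfps n k, z = psi (\sum_i c i * g i)) ->
    (forall z, ord_ge N z -> J z) ->
  (gaps N (fun z => exists f, z = psi f) + ('C(n + s, s) - \rank jets) <= gaps N J)%N.
Proof.
move=> Jgen tail; have [T [T0 Tlt]] := mx_flag jets.
rewrite -card_bmultinom.
pose L i z := exists2 f, z = psi f & (jet f <= T i)%MS.
have JL z : J z -> L 0%N z.
  by move=> /Jgen[c ->]; exists (\sum_i c i * g i) => //; rewrite T0 jet_comb.
apply: leq_trans (leq_gaps N JL).
apply: leq_trans (@gaps_flag _ N L (#|{: 'X_{1..n < s.+1}}| - \rank jets) _ _ _).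
- by rewrite leq_add2r; apply: leq_gaps => z [f -> _]; exists f.
- move=> i _ c _ _ [f1 -> f1T] [f2 -> f2T]; exists (c *: f1 + f2).
    by rewrite paramD paramZ.
  by rewrite jetD jetZ addmx_sub // scalemx_sub.
- by move=> z /tail/JL.
move=> i il; have := Tlt i il; rewrite ltmxE => /andP[sub nsub].
split=> [_ [f -> fT]|sub']; first by exists f => //; apply: submx_trans sub.
case/row_subPn: nsub => j; apply/negP; rewrite negbK.
have [f fE] := jet_surj (row j (T i.+1)).
have [|f' ff' f'T] := sub' (psi f); first by exists f => //; rewrite fE row_sub.
rewrite -fE -[f](subrK f') jetD jet0 ?add0r //; apply: ker_psi.
by rewrite paramB ff' subrr.
Qed.
End Colength.

(** * Eigenvalues of a derivation of R on the cotangent space *)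

Section EulerDerivation.
Variables (n : nat) (k : fieldType) (psi : {lrmorphism mfps n k -> fps k}).
Hypothesis ker_psi : forall f, psi f = 0 -> mord_ge 2 f.
Variable c : nat.
Hypothesis psi_conductor : forall z, ord_ge c z -> exists f, z = psi f.
Variables (a : fps k) (g : 'I_n -> mfps n k).
Hypothesis a_ord : ord_ge 1 a.
Hypothesis g_ord : forall i, mord_ge 1 (g i).
Hypothesis gE : forall i, psi (g i) = a * fps_deriv (psi (mfpsX k i)).

Definition linear_part : 'M[k]_n := \matrix_(i, j) g i U_(j)%MM.

(** The lift of a d/dt to k[[X]]. *)
Let delta f : mfps n k := \sum_i mfps_deriv i f * g i.

Let deltaD f h : delta (f + h) = delta f + delta h.
Proof.
rewrite /delta -big_split /=; apply: eq_bigr => i _.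
by rewrite mfps_derivD mulrDl.
Qed.

Let psi_delta f : psi (delta f) = a * fps_deriv (psi f).
Proof.
rewrite param_chain_rule param_sum mulr_sumr; apply: eq_bigr => i _.
by rewrite paramM gE mulrCA.
Qed.

Let delta_ord f : mord_ge 2 f -> mord_ge 2 (delta f).
Proof.
move=> f2; apply: mord_ge_sum => i _; rewrite -[2%N]/(1 + 1)%N.
by apply: mord_geM => //; apply: mord_ge_deriv.
Qed.

Let linear_form (v : 'rV[k]_n) : mfps n k := \sum_i v 0 i *: mfpsX k i.

Lemma mord_ge2 (f : mfps n k) : mord_ge 1 f -> (forall j, f U_(j)%MM = 0) -> mord_ge 2 f.
Proof.
move=> f1 f2 m; rewrite ltnS leq_eqVlt => /orP[|/f1//].
by case/mdeg1P => j /eqP->.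
Qed.

Let linear_form_coef v j : linear_form v U_(j)%MM = v 0 j.
Proof.
rewrite mfps_sum (bigD1 j) // big1 => [|i ij].
  by rewrite [LHS]addr0 mfpsZ /= eqxx mulr1.
rewrite mfpsZ /=; case: eqP => [/(congr1 (fun m : 'X_{1..n} => m i))|].
  by rewrite !mnm1E eqxx eq_sym (negPf ij).
by rewrite mulr0.
Qed.

Let linear_form_ord v : mord_ge 1 (linear_form v).
Proof.
apply: mord_ge_sum => i _; apply: mord_geZ; apply/mord_ge1 => /=.
by case: eqP => // /(congr1 mdeg); rewrite mdeg0 mdeg1.
Qed.

Let delta_linear_form v l : v *m linear_part = l *: v ->
  mord_ge 2 (delta (linear_form v) - l *: linear_form v).
Proof.
move=> vA; have dE : delta (linear_form v) = \sum_i v 0 i *: g i.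
  apply: eq_bigr => i _; rewrite mfps_deriv_sum (bigD1 i) //= big1 => [|j ji].
    by rewrite mfps_derivZ mfps_deriv_X eqxx scale1r addr0 -scalerAl mul1r.
  by rewrite mfps_derivZ mfps_deriv_X eq_sym (negPf ji) scale0r scaler0.
apply: mord_ge2 => [|j].
  apply: mord_geB; last exact: mord_geZ.
  by rewrite dE; apply: mord_ge_sum => i _; apply: mord_geZ.
rewrite mfpsB mfpsZ linear_form_coef dE mfps_sum.
have /rowP/(_ j) := vA; rewrite !mxE => <-.
apply/eqP; rewrite subr_eq0; apply/eqP/eq_bigr => i _.
by rewrite mfpsZ mxE.
Qed.

(** The derivation a d/dt of R = psi (k[[X]]) acts on m / m^2 through
    [linear_part]. With u the coefficient of t in a, it multiplies the leading
    term of a series of order e by u e. An eigenvector has a representative of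
    greatest order e in its class modulo m^2, and if the eigenvalue l differed
    from u e, the derivation minus u e would produce, up to the scalar l - u e, a
    representative of greater order. *)
Lemma eigenvalue_linear_part l : eigenvalue linear_part l ->
  exists2 e, (0 < e)%N & l = a 1%N *+ e.
Proof.
case/eigenvalueP => v vA v0; set w := linear_form v.
have nw : ~ mord_ge 2 w.
  move=> w2; case/eqP: v0; apply/rowP => j; rewrite mxE -linear_form_coef.
  by apply: w2; rewrite mdeg1.
pose cls (f : mfps n k) := mord_ge 2 (f - w).
have ncls f : cls f -> ~ mord_ge 2 f.
  by move=> fw f2; apply: nw; rewrite -[w](subKr f); apply: mord_geB.
(* A product of two elements of positive order at least c lies in m^2. *)
have bounded f e : cls f -> fps_ord (psi f) e -> (e < c.+1 + c.+1)%N.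
  move=> fw [_ fe]; rewrite ltnNge; apply/negP => ce; case: (ncls f fw).
  have [z zc zE] := ord_ge_div (fps_ordXn k c.+1) (ord_geW ce fe).
  have [f1 f1E] := psi_conductor (ord_geW (leqnSn c) zc).
  have [f2 f2E] := psi_conductor
    (ord_geW (leqnSn c) (fps_ord_ge (fps_ordXn k c.+1))).
  have f12 : mord_ge 2 (f1 * f2).
    rewrite -[2%N]/(1 + 1)%N; apply: mord_geM; apply/mord_ge1; rewrite -(param0 psi).
      by rewrite -f1E zc.
    by rewrite -f2E fpsXnE.
  rewrite -[f](subrK (f1 * f2)); apply: mord_geD => //; apply: ker_psi.
  by rewrite paramB paramM -f1E -f2E zE subrr.
have ex_e : exists e, `[< exists2 f, cls f & fps_ord (psi f) e >].
  have : psi w != 0 by apply/eqP => /ker_psi.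
  case/fps_ord_ex => e we; exists e; apply/asboolP; exists w => //.
  by rewrite /cls subrr.
have ub e : `[< exists2 f, cls f & fps_ord (psi f) e >] -> (e <= c.+1 + c.+1)%N.
  by move=> /asboolP[f fw fe]; apply: ltnW; apply: bounded fe.
case: (ex_maxnP ex_e ub) => e /asboolP[f fw fe] maxe; exists e.
  apply: (@ord_ge_fps_ord _ 1 e (psi f) _ fe).
  apply: ord_ge_param; rewrite -[f](subrK w); apply: mord_geD.
    exact: mord_geW fw.
  exact: linear_form_ord.
apply/eqP; rewrite -subr_eq0; apply/negPn/negP => mu0.
set mu := l - _ in mu0.
have ord_a : a = fpsX k * FPS (fun i => a i.+1).
  by apply: fpsP => -[|i]; rewrite fpsMX //; apply: a_ord.
pose h := delta f - (a 1%N *+ e) *: f.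
have hord : ord_ge e.+1 (psi h).
  move=> i; rewrite paramB psi_delta paramZ fpsB fpsZ [X in X * fps_deriv _]ord_a -mulrA fpsMX.
  case: fe => fe0 fe ie; case: i ie => [|i] ie.
    have [e0|e0] := posnP e; first by rewrite e0 mulr0n mul0r subrr.
    by rewrite fe // mulr0 subrr.
  rewrite ltnS in ie.
  have fd : ord_ge i (fps_deriv (psi f)).
    by apply: ord_ge_deriv; apply: ord_geW fe.
  rewrite -[i in X in X - _]add0n (@fpsM_low _ 0 i) //= /fps_deriv /=.
  move: ie; rewrite leq_eqVlt => /orP[/eqP->|/fe->]; last by rewrite mul0rn !mulr0 subrr.
  by rewrite mulrnAr mulrnAl subrr.
have hcls : mord_ge 2 (h - mu *: w).
  have -> : h - mu *: w =
      (delta (f - w) - (a 1%N *+ e) *: (f - w)) + (delta w - l *: w).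
    have dE : delta f = delta (f - w) + delta w by rewrite -deltaD subrK.
    rewrite /h /mu dE scalerBr scalerBl.
    move: (delta _) (delta _) (_ *: f) (_ *: w) (_ *: w) => d1 d2 d3 d4 d5.
    by ring.
  apply: mord_geD; last exact: delta_linear_form.
  by apply: mord_geB; [apply: delta_ord | apply: mord_geZ].
have mh : cls (mu^-1 *: h).
  rewrite /cls -[w]scale1r -(mulVf mu0) -scalerA -scalerBr.
  exact: mord_geZ.
have : psi (mu^-1 *: h) != 0 by apply/eqP => /ker_psi /(ncls _ mh).
case/fps_ord_ex => e' he'.
have /maxe : `[< exists2 f, cls f & fps_ord (psi f) e' >].
  by apply/asboolP; exists (mu^-1 *: h).
rewrite leqNgt (ord_ge_fps_ord _ he') //.
by rewrite paramZ; apply: ord_geZ.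
Qed.
End EulerDerivation.

(** * The parametrization of R and its relations among the derivatives *)

Section Param.
Local Open Scope quotient_scope.
Variables (n : nat) (k : fieldType) (I : idealr (mfps n k)).
Local Notation R := {ideal_quot I}.
Variable phi : {lrmorphism R -> fps k}.

Definition param (f : mfps n k) : fps k := phi (\pi_R f).

Lemma param_zmod_morphism : zmod_morphism param.
Proof. by move=> f g; rewrite /param !rmorphB. Qed.
HB.instance Definition _ :=
  GRing.isZmodMorphism.Build (mfps n k) (fps k) param param_zmod_morphism.

Lemma param_monoid_morphism : monoid_morphism param.
Proof. by split=> [|f g]; rewrite /param ?rmorph1 ?rmorphM. Qed.
HB.instance Definition _ :=
  GRing.isMonoidMorphism.Build (mfps n k) (fps k) param param_monoid_morphism.

Lemma param_scalable : scalable param.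
Proof.
move=> c f; rewrite /param -linearZ_LR; congr (phi _).
by rewrite -pi_quot_scale.
Qed.
HB.instance Definition _ :=
  GRing.isScalable.Build k (mfps n k) (fps k) *:%R param param_scalable.

Lemma pi_eq0 (f : mfps n k) : \pi_R f = 0 <-> f \in I.
Proof.
rewrite -[f in f \in I]subr0 Quotient.idealrBE.
by rewrite (rmorph0 (\pi_R : mfps n k -> R)); split=> [->|/eqP].
Qed.

Hypothesis phi_inj : injective phi.

Lemma param_ker (f : mfps n k) : param f = 0 -> f \in I.
Proof.
by move=> f0; apply/pi_eq0/phi_inj; rewrite [LHS]f0 rmorph0.
Qed.

Lemma param_ideal f : f \in I -> param f = 0.
Proof. by move=> /pi_eq0 f0; rewrite /param f0 rmorph0. Qed.

End Param.

Section Relations.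
Local Open Scope quotient_scope.
Variables (n : nat) (k : fieldType) (I : idealr (mfps n k)).
Local Notation R := {ideal_quot I}.
Variables (m : nat) (f : 'I_m -> mfps n k).
Hypothesis I_gen : forall g : mfps n k, g \in I <-> ideal_generated_by f g.
Local Notation U := (lspan (fun j => differential I (f j))).

(** The differential of a multiple of f_j is the multiple of df_j up to a multiple
    of f_j, which is zero in R. *)
Lemma differential_in_relations F : F \in I -> differential I F \in U.
Proof.
move=> /I_gen[a ->]; apply/asboolP; exists (fun j => \pi_R (a j)).
apply/rowP => i; rewrite summxE mxE mfps_deriv_sum raddf_sum.
apply: eq_bigr => j _; rewrite !mxE mfps_derivM raddfD /=.
have -> : \pi_R (mfps_deriv i (a j) * f j) = 0.
  apply/pi_eq0; apply: idealMr; apply/I_gen; exists (fun j' => (j' == j)%:R).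
  rewrite (bigD1 j) //= eqxx mul1r big1 ?addr0 // => j' /negPf->.
  by rewrite mul0r.
by rewrite add0r rmorphM.
Qed.

Lemma relations_lift (c : 'rV[R]_n) : c \in U -> exists a : 'I_m -> mfps n k,
  forall i, c 0 i = \pi_R (\sum_j a j * mfps_deriv i (f j)).
Proof.
move=> /asboolP[b bE]; exists (fun j => repr (b j)) => i.
rewrite bE summxE raddf_sum; apply: eq_bigr => j _.
by rewrite !mxE [RHS]rmorphM /= reprK.
Qed.

(** The series f_j start in degree 2, hence the matrix of linear coefficients of
    a combination of the df_j is a combination of Hessian matrices. *)
Lemma relation_linear_part_sym (a : 'I_m -> mfps n k) i l :
    (forall j, mord_ge 2 (f j)) ->
  (\sum_j a j * mfps_deriv i (f j)) U_(l)%MM =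
  (\sum_j a j * mfps_deriv l (f j)) U_(i)%MM.
Proof.
move=> f2; rewrite !mfps_sum; apply: eq_bigr => j _.
rewrite !(@mfpsM_low _ _ 1) ?mdeg1 //; try exact: mord_ge_deriv.
rewrite !mfps_derivE addmC; congr (_ * (_ *+ _)).
by rewrite !mnm1E eq_sym.
Qed.

Section Torsion.
Hypothesis char0 : [pchar k] =i pred0.
Variable phi : {lrmorphism R -> fps k}.
Hypothesis phi_inj : injective phi.
Hypothesis I_ord : forall g, g \in I -> mord_ge 2 g.
Hypothesis torsion_free : forall w : Omega I f, is_torsion w -> w = 0.
Local Notation psi := (param phi).
Local Notation x' i := (fps_deriv (psi (mfpsX k i))).

Lemma param_var_neq0 i : psi (mfpsX k i) != 0.
Proof.
apply/eqP => /(param_ker phi_inj)/I_ord/(_ U_(i)%MM).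
rewrite mdeg1 /= eqxx => /(_ isT)/eqP; exact/negP/oner_neq0.
Qed.

Lemma fps_ord_deriv (z : fps k) p : fps_ord z p.+1 -> fps_ord (fps_deriv z) p.
Proof.
move=> [zp zlt]; split; last exact: ord_ge_deriv.
by rewrite fps_derivE -mulr_natr mulf_neq0 // ((pcharf0P _).1 char0).
Qed.

Lemma param_var_ord i : exists p, fps_ord (psi (mfpsX k i)) p.+1.
Proof.
have [[|p] xp] := fps_ord_ex (param_var_neq0 i); last by exists p.
by have := ord_ge_fps_ord (@ord_ge_param_var _ _ psi i) xp.
Qed.

(** The R-linear map that sends dX_i to x_i'. *)
Definition eval_relation (c : 'rV[R]_n) : fps k := \sum_i phi (c 0 i) * x' i.

Let phiM a b : phi (a * b) = phi a * phi b. Proof. exact: rmorphM. Qed.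

Let eval_relationD c d : eval_relation (c + d) = eval_relation c + eval_relation d.
Proof.
rewrite -big_split /=; apply: eq_bigr => i _.
by rewrite mxE raddfD mulrDl.
Qed.

Let eval_relationZ r c : eval_relation (r *: c) = phi r * eval_relation c.
Proof.
by rewrite mulr_sumr; apply: eq_bigr => i _; rewrite mxE phiM mulrA.
Qed.

Let eval_differential F : F \in I -> eval_relation (differential I F) = 0.
Proof.
move=> FI; transitivity (fps_deriv (psi F)).
  by rewrite param_chain_rule; apply: eq_bigr => i _; rewrite mxE.
by rewrite (param_ideal _ FI); apply: fpsP => i; rewrite /= mul0rn.
Qed.

(** Omega has rank one: by the separable equations of the x_i over k[[x_0]], a
    nonzero multiple of each dX_i lies in the span of dX_0 and the relations. So a
    multiple of c reduces to b dX_0, where b x_0' = 0. Hence c is a torsion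
    element of Omega, and vanishes there. *)
Lemma eval_kernel_relations c : eval_relation c = 0 -> c \in U.
Proof.
have [i0|no_index _] := pickP 'I_n; last first.
  have -> : c = 0 by apply/rowP => i; have := no_index i.
  exact: rpred0.
move=> _ c0; have [p xp] := param_var_ord i0.
have [x'0 _] := fps_ord_deriv xp.
have /choice[F FE] : forall i, exists F : mfps n k, i != i0 ->
    [/\ psi F = 0, psi (mfps_deriv i F) != 0
      & forall l, l != i0 -> l != i -> mfps_deriv l F = 0].
  move=> i; have [->|ii0] := eqVneq i i0; first by exists 0.
  by have [F FE] := param_relation char0 xp ii0; exists F.
pose q i := \pi_R (mfps_deriv i (F i)).
pose r := \prod_(i | i != i0) q i.
have r0 : phi r != 0.
  rewrite rmorph_prod; apply/prodf_neq0 => i ii0.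
  by case: (FE i ii0).
pose r' i := \prod_(l | (l != i0) && (l != i)) q l.
have rE i : i != i0 -> r = q i * r' i by move=> ii0; rewrite /r (bigD1 i).
pose u := \sum_(i | i != i0) (c 0 i * r' i) *: differential I (F i).
have FI i : i != i0 -> F i \in I by move=> ii0; apply: (param_ker phi_inj); case: (FE i ii0).
have uU : u \in U.
  by apply: rpred_sum => i ii0; apply: rpredZ; apply/differential_in_relations/FI.
have ev_u : eval_relation u = 0.
  have ev0 : eval_relation 0 = 0.
    by apply: big1 => i _; rewrite mxE rmorph0 mul0r.
  rewrite (big_morph _ eval_relationD ev0) big1 // => i ii0.
  by rewrite eval_relationZ eval_differential ?mulr0 //; apply: FI.
have off i : i != i0 -> (r *: c) 0 i = u 0 i.
  move=> ii0; rewrite mxE summxE (bigD1 i) //= !mxE big1 ?addr0 => [|l /andP[li0 li]].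
    by rewrite -/(q i) (rE i ii0) [RHS]mulrC mulrA mulrAC.
  rewrite !mxE; have [_ _ ->] := FE l li0; rewrite // 1?eq_sym //.
  by rewrite rmorph0 mulr0.
have rc_u : r *: c = u.
  apply/rowP => i; have [->|/off//] := eqVneq i i0.
  have : eval_relation (r *: c - u) = 0.
    by rewrite -scaleN1r eval_relationD !eval_relationZ c0 ev_u !mulr0 addr0.
  rewrite /eval_relation (bigD1 i0) //= big1 => [|l li0].
    rewrite addr0 => /eqP; rewrite mulf_eq0 => /orP[/eqP e|/eqP e].
      apply/eqP; rewrite -subr_eq0; apply/eqP/phi_inj; rewrite rmorph0 -e.
      by rewrite !mxE.
    by move: x'0; rewrite e eqxx.
  by rewrite mxE off // [X in _ + X]mxE subrr rmorph0 mul0r.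
have c_torsion : is_torsion (\pi_(modquot U) c : Omega I f).
  exists r.
    move=> a b /(congr1 phi); rewrite !phiM => /(mulfI r0); exact: phi_inj.
  rewrite [_ *: _]pi_modquotZ rc_u; apply: etrans (pi_modquot0 _).
  by apply/modquot_eq; rewrite subr0.
have /esym/(etrans (pi_modquot0 _))/esym/modquot_eq := torsion_free c_torsion.
by rewrite subr0.
Qed.

End Torsion.
End Relations.

(** * Koszul relations *)

Lemma mord_ge_prod (n : nat) (k : comNzRingType) e (a : 'I_e -> mfps n k) :
  (forall j, mord_ge 1 (a j)) -> mord_ge e (\prod_j a j).
Proof.
elim: e a => [|e IH] a a1; first by [].
rewrite big_ord_recl; apply: (@mord_geM _ _ 1 e) => //.
exact: IH.
Qed.

Lemma mord_ge_ideal_pow (n : nat) (k : comNzRingType) e (g : mfps n k) :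
  ideal_pow (ideal_generated_by (fun i : 'I_n => mfpsX k i)) e g -> mord_ge e g.
Proof.
move=> [r [c [a [aX ->]]]]; apply: mord_ge_sum => i _; apply: mord_ge_mull.
apply: mord_ge_prod => j; have [b ->] := aX i j.
apply: mord_ge_sum => l _; apply: mord_ge_mull; apply/mord_ge1 => /=.
by case: eqP => // /(congr1 mdeg); rewrite mdeg0 mdeg1.
Qed.

Lemma eigenvalue_traceless (k : closedFieldType) (A : 'M[k]_2) : \tr A = 0 ->
  exists l, eigenvalue A l /\ eigenvalue A (- l).
Proof.
move=> trA; have [l lE] : exists l : k, l ^+ 2 = - \det A.
  have [l] := @solve_monicpoly k 2 (fun i => if i == 0%N then - \det A else 0) isT.
  by rewrite !big_ord_recl big_ord0 /= mul0r expr0 mulr1 !addr0 => lE; exists l.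
have rootE x : root (char_poly A) x = (x ^+ 2 == - \det A).
  rewrite /root horner_coef size_char_poly !big_ord_recl big_ord0 /=.
  rewrite char_poly_det (char_poly_trace A isT) trA oppr0 mul0r.
  have := char_poly_monic A; rewrite monicE lead_coefE size_char_poly /= => /eqP->.
  by rewrite expr0 expr2 mulrNN !mulr1 !mul1r addr0 add0r addrC addr_eq0.
exists l; rewrite !eigenvalue_root_char !rootE sqrrN lE.
by rewrite eqxx.
Qed.

Section Koszul.
Local Open Scope quotient_scope.
Variables (n s : nat) (k : closedFieldType) (I : idealr (mfps n k)).
Local Notation R := {ideal_quot I}.
Variables (m : nat) (f : 'I_m -> mfps n k).
Hypothesis I_gen : forall g : mfps n k, g \in I <-> ideal_generated_by f g.
Hypothesis char0 : [pchar k] =i pred0.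
Hypothesis n_ge2 : (2 <= n)%N.
Hypothesis s_ge1 : (1 <= s)%N.
Variable phi : {lrmorphism R -> fps k}.
Hypothesis phi_inj : injective phi.
Hypothesis I_ord : forall g, g \in I -> mord_ge s.+1 g.
Hypothesis torsion_free : forall w : Omega I f, is_torsion w -> w = 0.
Local Notation psi := (param phi).
Local Notation x' i := (fps_deriv (psi (mfpsX k i))).
Variable g : 'I_n -> mfps n k.
Hypothesis g_prop : forall i j, psi (g j) * x' i = psi (g i) * x' j.

Let f_ord j : mord_ge s.+1 (f j).
Proof.
apply/I_ord/I_gen; exists (fun j' => (j' == j)%:R).
rewrite (bigD1 j) //= eqxx mul1r big1 ?addr0 // => j' /negPf->.
by rewrite mul0r.
Qed.

Let I_ord2 h : h \in I -> mord_ge 2 h.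
Proof. by move/I_ord; apply: mord_geW. Qed.

(** The relation g_j dX_i - g_i dX_j, which holds because the g_i are
    proportional to the x_i', lifts to a combination of differentials of
    elements of I. *)
Lemma koszul_relation i j : i != j -> exists h : 'I_n -> mfps n k,
  [/\ forall l, mord_ge s (h l),
      forall p l, h p U_(l)%MM = h l U_(p)%MM,
      g j - h i \in I, g i + h j \in I
    & forall l, l != i -> l != j -> h l \in I].
Proof.
move=> ij.
pose c : 'rV[R]_n := \row_l (\pi_R (g j) *+ (l == i) - \pi_R (g i) *+ (l == j)).
have ci : c 0 i = \pi_R (g j) by rewrite mxE eqxx (negPf ij) subr0.
have cj : c 0 j = - \pi_R (g i) by rewrite mxE eqxx eq_sym (negPf ij) sub0r.
have cl l : l != i -> l != j -> c 0 l = 0.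
  by move=> li lj; rewrite mxE (negPf li) (negPf lj) subr0.
have c0 : eval_relation phi c = 0.
  rewrite /eval_relation (bigD1 i) //= (bigD1 j) 1?eq_sym //= big1 => [|l /andP[li lj]].
    rewrite addr0 ci cj rmorphN mulNr; apply/eqP; rewrite subr_eq0; apply/eqP.
    exact: g_prop.
  by rewrite cl // rmorph0 mul0r.
have [a aE] := relations_lift (eval_kernel_relations I_gen char0 phi_inj I_ord2 torsion_free c0).
exists (fun l => \sum_j a j * mfps_deriv l (f j)); split.
- move=> l; apply: mord_ge_sum => j' _; apply: mord_ge_mull; exact: mord_ge_deriv.
- move=> p l; apply: relation_linear_part_sym => j'; exact: mord_geW (f_ord j').
- by apply/pi_eq0; rewrite rmorphB /= -aE ci subrr.
- by apply/pi_eq0; rewrite rmorphD /= -aE cj subrr.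
- by move=> l li lj; apply/pi_eq0; rewrite -aE cl.
Qed.

Let other i : exists j, j != i :> 'I_n.
Proof.
have [i0|i0] := eqVneq (i : nat) 0%N.
  by exists (Ordinal n_ge2); apply/eqP => /(congr1 val) /= e; rewrite -e in i0.
exists (Ordinal (ltnW n_ge2)); apply/eqP => /(congr1 val) /= e; by rewrite -e in i0.
Qed.

(** The coefficients of the differentials of elements of I have order at least
    s. *)
Lemma koszul_ord j : mord_ge s (g j).
Proof.
have [i ij] := other j; have [h [h_ord _ gh _ _]] := koszul_relation ij.
rewrite -[g j](subrK (h i)); apply: mord_geD => //.
exact: mord_geW (I_ord gh).
Qed.

Lemma koszul_linear_part_offdiag i j l : i != j -> l != i -> l != j ->
  g j U_(l)%MM = 0.
Proof.
move=> ij li lj; have [h [_ h_sym gh _ hl]] := koszul_relation ij.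
have -> : g j U_(l)%MM = h i U_(l)%MM.
  apply/eqP; rewrite -subr_eq0 -mfpsB; apply/eqP/(I_ord2 gh).
  by rewrite mdeg1.
by rewrite h_sym (I_ord2 (hl l li lj)) // mdeg1.
Qed.

Lemma koszul_linear_part_diag i j : i != j ->
  g i U_(i)%MM + g j U_(j)%MM = 0.
Proof.
move=> ij; have [h [_ h_sym gh gh' _]] := koszul_relation ij.
have -> : g j U_(j)%MM = h i U_(j)%MM.
  apply/eqP; rewrite -subr_eq0 -mfpsB; apply/eqP/(I_ord2 gh).
  by rewrite mdeg1.
rewrite h_sym -mfpsD; apply: (I_ord2 gh').
by rewrite mdeg1.
Qed.

(** For three distinct indices the sums of any two of the three diagonal entries
    vanish, hence so do the entries. *)
Lemma koszul_ord2 j : (2 < n)%N -> mord_ge 2 (g j).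
Proof.
move=> n3; apply: mord_ge2; first exact: mord_geW (koszul_ord j).
have third (i1 i2 : 'I_n) : exists i, (i != i1) && (i != i2).
  have : (0 < #|predC (pred2 i1 i2)|)%N.
    rewrite -(ltn_add2l #|pred2 i1 i2|) cardC card_ord addn0 card2.
    by apply: leq_ltn_trans n3; case: (i1 != i2).
  by case/card_gt0P => i; rewrite !inE negb_or => ?; exists i.
move=> l; have [->|lj] := eqVneq l j; last first.
  have [i /andP[il ij]] := third l j; apply: (@koszul_linear_part_offdiag i) => //.
  by rewrite eq_sym.
have [i1 /andP[i1j _]] := third j j; have [i2 /andP[i2j i21]] := third j i1.
have e1 := koszul_linear_part_diag i1j; have e2 := koszul_linear_part_diag i2j.
have e3 := koszul_linear_part_diag i21.
have : g j U_(j)%MM *+ 2 = 0.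
  rewrite -(subrr 0) -{1}(addr0 0) -{1}e1 -{1}e2 -e3.
  by ring.
by move/eqP; rewrite -mulr_natr mulf_eq0 ((pcharf0P _).1 char0) orbF => /eqP.
Qed.

Variables (c : nat) (a : fps k).
Hypothesis phi_conductor : forall z, ord_ge c z -> exists r, z = phi r.
Hypothesis a_ord : ord_ge 1 a.
Hypothesis gE : forall i, psi (g i) = a * x' i.

Let psi_conductor z : ord_ge c z -> exists h, z = psi h.
Proof. by case/phi_conductor => r ->; exists (repr r); rewrite /param reprK. Qed.

(** For n = 2 the diagonal relation says that the trace is zero, so the
    eigenvalues are l and - l. Both are positive integral multiples of the
    coefficient u of t in a, which forces u = 0 and then l = 0. *)
Lemma koszul_linear_part_singular : n = 2 -> eigenvalue (linear_part g) 0.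
Proof.
move=> n2; have g1 i : mord_ge 1 (g i) by apply: mord_geW (koszul_ord i).
have eig := eigenvalue_linear_part (fun h h0 => I_ord2 (param_ker phi_inj h0))
  psi_conductor a_ord g1 gE.
have trA : \tr (linear_part g) = 0.
  have [j ji] := other (Ordinal (ltnW n_ge2)); set i := Ordinal _ in ji.
  rewrite /mxtrace (bigD1 i) //= (bigD1 j) //= !mxE big_pred0 => [|l].
    by rewrite addr0 koszul_linear_part_diag // eq_sym.
  apply/negbTE; rewrite negb_and !negbK; move: ji; rewrite -!val_eqE /=.
  by have := ltn_ord l; have := ltn_ord j; lia.
have [l [l1 l2]] : exists l, eigenvalue (linear_part g) l /\ eigenvalue (linear_part g) (- l).
  move: (linear_part g) trA; rewrite n2; exact: eigenvalue_traceless.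
have [e1 e1_gt0 l1E] := eig _ l1; have [e2 _ l2E] := eig _ l2.
have : a 1%N *+ (e1 + e2) == 0 by rewrite mulrnDr -l1E -l2E subrr.
rewrite -mulr_natr mulf_eq0 ((pcharf0P _).1 char0) addn_eq0 -[e1 == 0%N]negbK -lt0n.
rewrite e1_gt0 /= orbF => /eqP a1; by rewrite l1E a1 mul0rn in l1.
Qed.

(** For s at least 2 the trivial bound n on the rank suffices. For s = 1 the jets
    amount to the linear parts: they vanish for n at least 3, and are linearly
    dependent for n = 2. *)
Lemma rank_jets : (s.+1 * \rank (jets s g) <= 'C(n + s, s))%N.
Proof.
have [s2|s1] := ltnP 1 s.
  apply: leq_trans (leq_mul_binomial n_ge2 s2).
  by rewrite leq_mul2l rank_leq_row orbT.
have {s1} s1 : s = 1%N by apply/eqP; rewrite eqn_leq s1.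
have jets0 (v : 'rV_n) : v *m linear_part g = 0 -> v *m jets s g = 0.
  move=> /rowP v0; apply/rowP => j; rewrite !mxE.
  set mm := (enum_val j : 'X_{1..n < s.+1}).
  have : (mdeg mm <= 1)%N by rewrite -[X in (_ <= X)%N]s1 -ltnS bmdeg.
  rewrite leq_eqVlt => /orP[/mdeg1P[l /eqP ml]|m0].
    have := v0 l; rewrite !mxE => v0l; rewrite -[RHS]v0l; apply: eq_bigr => i _.
    by rewrite !mxE -/mm ml.
  apply: big1 => i _; rewrite !mxE -/mm (@koszul_ord i) ?mulr0 //.
  exact: leq_trans s_ge1.
have [n3|n2] := ltnP 2 n.
  have -> : jets s g = 0.
    rewrite -[jets s g]mul1mx; apply/row_matrixP => i; rewrite row_mul row0.
    apply: jets0; rewrite -row_mul mul1mx; apply/rowP => l; rewrite !mxE.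
    by rewrite koszul_ord2 // mdeg1.
  by rewrite mxrank0 muln0.
have {n2} n2 : n = 2 by apply/eqP; rewrite eqn_leq n2.
have /eigenvalueP[v vA v0] := koszul_linear_part_singular n2.
have : (\rank (jets s g) < 2)%N.
  rewrite ltnNge; apply/negP => rk; case/eqP: v0; apply/eqP.
  have free : row_free (jets s g) by rewrite -row_leq_rank {1}n2.
  by rewrite -(mulmx_free_eq0 _ free) jets0 // vA scale0r.
have -> : 'C(n + s, s) = 3%N by rewrite s1 n2.
by move: (\rank _) => rk; lia.
Qed.

End Koszul.

(** * The theorem *)

Theorem theorem3
  (k : closedFieldType) (char0 : [pchar k] =i pred0)
  (n s : nat) (n_ge2 : (2 <= n)%N) (s_ge1 : (1 <= s)%N)
  (I : idealr (mfps n k))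
  (m : nat) (f : 'I_m -> mfps n k)
  (I_gen : forall g : mfps n k, g \in I <-> ideal_generated_by f g)
  (R_domain : GRing.integral_domain_axiom {ideal_quot I})
  (R_dim1 : krull_dim {ideal_quot I} 1)
  (I_sub : forall g : mfps n k, g \in I ->
     ideal_pow (ideal_generated_by (fun i : 'I_n => mfpsX k i)) s.+1 g)
  (phi : {lrmorphism {ideal_quot I} -> fps k})
  (phi_inj : injective phi)
  (K_frac : forall z : laurent k, exists a b : {ideal_quot I},
     b != 0 /\ z = tofrac (phi a) / tofrac (phi b))
  (R_closure : forall z : laurent k,
     integralOver (fun r : {ideal_quot I} => tofrac (phi r)) z
       <-> exists g : fps k, z = tofrac g)
  (lR lD : nat) (vDinv : int)
  (lR_length : has_length (modquot (restr_im phi)) lR)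
  (lD_length : has_length (modquot (derivative_module phi)) lD)
  (vDinv_attained : exists alpha : laurent k,
     derivative_module_inv phi alpha /\ laurent_val alpha vDinv)
  (vDinv_min : forall (alpha : laurent k) (e : int),
     derivative_module_inv phi alpha -> laurent_val alpha e -> vDinv <= e)
  (bound : vDinv%:~R <
     ('C(n + s, s))%:R * (s%:R / s.+1%:R) + lR%:R - lD%:R :> rat) :
  exists w : Omega I f, w != 0 /\ is_torsion w.
Proof.
apply: contrapT => no_torsion.
have torsion_free (w : Omega I f) : is_torsion w -> w = 0.
  move=> tw; apply/eqP/negPn/negP => w0; apply: no_torsion; by exists w.
have I_ord g : g \in I -> mord_ge s.+1 g by move/I_sub/mord_ge_ideal_pow.
have I_ord2 g : g \in I -> mord_ge 2 g by move/I_ord; apply: mord_geW.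
set psi := param phi; pose x' i := fps_deriv (psi (mfpsX k i)).
have [c phi_conductor] : exists c, forall z, ord_ge c z -> exists r, z = phi r.
  apply: (conductor lR_length) => z; have [a [b [b0 zE]]] := K_frac (tofrac z).
  have phib0 : phi b != 0 by rewrite -(rmorph0 phi) (inj_eq phi_inj).
  exists a, b; split=> //; apply/eqP; rewrite -tofrac_eq tofracM zE; apply/eqP.
  by rewrite mulrC divfK // tofrac_eq0.
(* alpha is al / t^N; the equations for alpha D are kept free of denominators
   until alpha is known to lie in t k[[t]]. *)
have [alpha [alpha_inv alpha_val]] := vDinv_attained.
have [N [d [al [alE al_ord eE]]]] := alpha_val.
have x'D i : (x' i : restr phi) \in derivative_module phi.
  apply/asboolP; exists (fun j => (j == i)%:R).
  by rewrite (bigD1 i) //= eqxx scale1r big1 ?addr0 // => j /negPf->; rewrite scale0r.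
have /choice[g gE0] : forall i, exists g : mfps n k, al * x' i = fpsX k ^+ N * psi g.
  move=> i; have [r rE] := alpha_inv _ (x'D i); exists (repr r).
  apply/eqP; rewrite -tofrac_eq !tofracM tofracXn /psi /param reprK -rE alE; apply/eqP.
  rewrite [RHS]mulrA [X in _ = X * _]mulrCA divff ?mulr1 //.
  by rewrite expf_neq0 // tofrac_eq0 (fps_ord_neq0 (fps_ordXn k 1)).
have XN0 : fpsX k ^+ N != 0 := fps_ord_neq0 (fps_ordXn k N).
have g_prop i j : psi (g j) * x' i = psi (g i) * x' j.
  by apply: (mulfI XN0); rewrite !mulrA -!gE0 mulrAC.
have g_ord j : mord_ge s (g j) :=
  koszul_ord I_gen char0 n_ge2 s_ge1 phi_inj I_ord torsion_free g_prop j.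
have g_ord1 j : mord_ge 1 (g j) := mord_geW s_ge1 (g_ord j).
have /choice[p pE] : forall i, exists p, fps_ord (psi (mfpsX k i)) p.+1.
  exact: param_var_ord.
pose i0 := Ordinal (ltnW n_ge2).
(* For x_i of least order p + 1, alpha x_i' has order d - N + p, and it lies in
   m, whose elements have order at least p + 1. *)
have Nd : (N < d)%N.
  have [i1 _ min_i1] := @arg_minnP _ i0 xpredT p isT.
  have psi_ord : ord_ge (p i1).+1 (psi (g i1)).
    apply: ord_ge_param_max => // i; apply: ord_geW (fps_ord_ge (pE i)).
    by rewrite ltnS min_i1.
  have ord_l := fps_ordM al_ord (fps_ord_deriv char0 (pE i1)).
  have : ord_ge (N + (p i1).+1) (al * x' i1).
    by rewrite gE0; apply: ord_geM => //; apply: fps_ord_ge (fps_ordXn k N).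
  by move=> /ord_ge_fps_ord/(_ ord_l); rewrite addnS -addSn leq_add2r.
have [a _ aE] : exists2 a, ord_ge (d - N) a & al = a * fpsX k ^+ N.
  apply: (ord_ge_div (fps_ordXn k N)); rewrite subnKC; last exact: ltnW.
  exact: fps_ord_ge.
pose e := (d - N)%N.
have a_ord : fps_ord a e.
  have a0 : a != 0.
    by apply: contra_neq (fps_ord_neq0 al_ord) => a0; rewrite aE a0 mul0r.
  have [e' ae'] := fps_ord_ex a0; rewrite aE in al_ord.
  have := fps_ord_uniq al_ord (fps_ordM ae' (fps_ordXn k N)).
  by rewrite /e => ->; rewrite addnK.
have gE i : psi (g i) = a * x' i.
  by apply: (mulfI XN0); rewrite -gE0 aE mulrCA mulrA.
have a_ord1 : ord_ge 1 a by apply: ord_geW (fps_ord_ge a_ord); rewrite /e subn_gt0.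
have rank_g := rank_jets I_gen char0 n_ge2 s_ge1 phi_inj I_ord torsion_free g_prop
  phi_conductor a_ord1 gE.
pose D (z : fps k) := (z : restr phi) \in derivative_module phi.
pose J (z : fps k) := exists2 y, D y & z = a * y.
have J_gen z : J z -> exists c : 'I_n -> mfps n k, z = psi (\sum_i c i * g i).
  move=> [y /asboolP[b yE] ->]; exists (fun i => repr (b i)).
  rewrite yE mulr_sumr /psi raddf_sum; apply: eq_bigr => i _.
  by rewrite [RHS]rmorphM /= -/psi gE mulrCA /psi /param reprK.
(* J contains the multiples of a x_0' by the conductor of R. *)
have [N1 J_tail] : exists N1, forall z, ord_ge N1 z -> J z.
  have jord := fps_ordM a_ord (fps_ord_deriv char0 (pE i0)).
  exists (e + p i0 + c)%N => z /(ord_ge_div jord)[w /phi_conductor[r ->] ->].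
  exists (phi r * x' i0); last by rewrite mulrCA.
  exact: rpredZ (x'D i0).
have psiJ z : J z -> exists f, z = psi f.
  by move/J_gen => [b ->]; exists (\sum_i b i * g i).
have J_tail' z : ord_ge (e + N1) z -> J z.
  by move=> z_ord; apply: J_tail; apply: ord_geW z_ord; apply: leq_addl.
have im_psi z : (exists f, z = psi f) -> (z : restr phi) \in restr_im phi.
  by case=> h ->; apply/asboolP; exists (\pi_({ideal_quot I})%qT h).
have lR_le : (lR <= gaps (e + N1) (fun z => exists f, z = psi f))%N.
  apply: leq_trans (leq_gaps _ im_psi).
  apply: submodule_chain_leq_gaps (proj1 lR_length) => z /J_tail'/psiJ.
  exact: im_psi.
have R_le_J := colength_bound (fun h h0 => I_ord _ (param_ker phi_inj h0)) g_ord J_gen J_tail'.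
have J_le_D : (gaps (e + N1) J <= e + gaps N1 D)%N.
  by apply: (gaps_shift _ a_ord) => z Dz; exists z.
have D_le : (gaps N1 D <= lD)%N := proj2 lD_length _ (submodule_chain_gaps _ N1).
have total : (lR + ('C(n + s, s) - \rank (jets s g)) <= e + lD)%N.
  apply: leq_trans (leq_trans _ J_le_D) _; last by rewrite leq_add2l.
  by apply: leq_trans R_le_J; rewrite leq_add2r.
have vE : vDinv = e%:Z by rewrite eE /e subzn // ltnW.
have : ((e + lD) * s.+1 < 'C(n + s, s) * s + lR * s.+1)%N.
  have s1_neq0 : s.+1%:R != 0 :> rat by rewrite pnatr_eq0.
  move: bound; rewrite vE ltrBrDr -(@ltr_pM2r _ s.+1%:R) ?ltr0n //.
  rewrite -pmulrn -natrD [X in _ < X]mulrDl mulrA divfK //.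
  by rewrite -!natrM -natrD ltr_nat.
move: rank_g total; move: (\rank _) 'C(_, _) => rk C; nia.
Qed.
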